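(* Let $\{(\tilde{\bm p}^k,\tilde{\bm q}^k,\bm t^k,\bm\lambda^k)\}$ be a sequence generated by PieADMM (defined in the context), assumed to be bounded, and let $L_f,L_g,L_{f,\tilde{\bm p}},L_{g,\tilde{\bm p}},L_{f,\tilde{\bm q}},L_{g,\tilde{\bm q}}>0$ be the Lipschitz constants described in the context. Suppose $H_1\succ L_{f,\tilde{\bm p}}I+L_{g,\tilde{\bm p}}I$, $H_2\succ 0$, $H_3\succ 0$, and $$\beta>\max\left\{\tfrac43(L_{f,\tilde{\bm q}}+L_{g,\tilde{\bm q}}),\ \frac{8(L_f^2+L_g^2)}{\sigma_{\min}(H_1)-L_{f,\tilde{\bm p}}-L_{g,\tilde{\bm p}}},\ \frac{8(L_f^2+L_g^2)+16\sigma_{\max}^2(H_2)}{\sigma_{\min}(H_2)},\ \frac{8L_f^2}{\sigma_{\min}(H_3)}\right\}.$$ Put $\bm w^k=(\tilde{\bm p}^k,\tilde{\bm q}^k,\bm t^k)$, $$\kappa_1=\tfrac{4}{\beta^2}\big(L_f^2+L_g^2+\sigma_{\max}^2(H_2)\big),\quad \kappa_2=\sigma_{\max}^2(H_3),\quad \kappa_3=\max\{2L_f^2,2\sigma_{\max}^2(H_2)\},\quad \kappa_4=\big(L_f+L_g+\beta+\sigma_{\max}(H_1)\big)^2,$$ $$\nu=\min\Big\{\tfrac12(\sigma_{\min}(H_1)-L_{f,\tilde{\bm p}}-L_{g,\tilde{\bm p}})-\tfrac4\beta(L_f^2+L_g^2),\ \tfrac12\sigma_{\min}(H_2)-\tfrac4\beta(L_f^2+L_g^2)-\tfrac8\beta\sigma_{\max}^2(H_2),\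 \tfrac12\sigma_{\min}(H_3)-\tfrac4\beta L_f^2\Big\},$$ and $\theta_k=\|\bm w^k-\bm w^{k-1}\|^2+\|\bm w^{k-1}-\bm w^{k-2}\|^2$. Let $\epsilon>0$. Then an $\epsilon$-stationary solution of the PGO model is found: if $\bm w^{\hat k}=(\tilde{\bm p}^{\hat k},\tilde{\bm q}^{\hat k},\bm t^{\hat k})$ is the first iterate that satisfies $$\theta_{\hat k}\le \epsilon^2/\max\{\kappa_1,\kappa_2,\kappa_3,\kappa_4\},$$ then $(\tilde{\bm p}^{\hat k},\tilde{\bm q}^{\hat k},\bm t^{\hat k})$, with multiplier $\bm\lambda^{\hat k}$, is an $\epsilon$-stationary solution of the PGO model. Moreover, $\hat k$ is no more than $$T:=\left\lceil \frac{2\max\{\kappa_1,\kappa_2,\kappa_3,\kappa_4\}}{\nu\epsilon^2}\,(\Phi^1-f^*-g^* )\right\rceil .$$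
   Context: Quaternions $\tilde q=q_0+q_1\mathbf i+q_2\mathbf j+q_3\mathbf k$ are identified with vectors $[q_0,q_1,q_2,q_3]\in\mathbb R^4$, with Hamilton multiplication, conjugate $\tilde q^*$, and $1=[1,0,0,0]$. $\mathbb U\subset\mathbb R^4$ is the set of unit quaternions (unit sphere). For $\bm t_i\in\mathbb R^3$ write $\tilde t_i=[0,\bm t_i]$. For a symmetric positive semidefinite matrix $M$, $\|x\|_M^2=x^\top Mx$; $\|\cdot\|$ is the Euclidean norm; $\sigma_{\min},\sigma_{\max}$ denote smallest and largest eigenvalues; $A\succ B$ means $A-B$ is positive definite. PGO model. Given a finite directed graph $\mathcal G=(\mathcal V,\mathcal E)$ with $\mathcal V=\{1,\dots,n\}$, data $\tilde q_{ij}\in\mathbb U$, $\bm t_{ij}\in\mathbb R^3$ for $(i,j)\in\mathcal E$ (with $\tilde t_{ij}=[0,\bm t_{ij}]$), and symmetric positive semidefinite $4\times4$ matrices $\Sigma_1,\Sigma_2$, define for $\tilde{\bm p}=(\tilde p_1,\dots,\tilde p_n)\in\mathbb R^{4n}$, $\tilde{\bm q}=(\tilde q_1,\dots,\tilde q_n)\in\mathbb R^{4n}$, $\bm t=(\bm t_1,\dots,\bm t_n)\in\mathbb R^{3n}$ $$f(\tilde{\bm p},\tilde{\bm q},\bm t)=\sum_{(i,j)\in\mathcal E}\|\tilde t_j-\tilde t_i-\tilde q_i\tilde t_{ij}\tilde p_i^*\|_{\Sigma_1}^2,\qquad g(\tilde{\bm p},\tilde{\bm q})=\sum_{(i,j)\in\mathcal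 E}\|\tilde p_j^*\tilde q_i\tilde q_{ij}-1\|_{\Sigma_2}^2 .$$ The PGO model is: minimize $f(\tilde{\bm p},\tilde{\bm q},\bm t)+g(\tilde{\bm p},\tilde{\bm q})$ subject to $\tilde{\bm p}=\tilde{\bm q}$, $\tilde{\bm p}\in\mathbb U^n$, $\tilde{\bm q}\in\mathbb R^{4n}$, $\bm t\in\mathbb R^{3n}$. Let $f^*=\inf f$ and $g^*=\inf g$, the infima taken over $\tilde{\bm p}\in\mathbb U^n$, $\tilde{\bm q}\in\mathbb R^{4n}$, $\bm t\in\mathbb R^{3n}$. Augmented Lagrangian. For $\beta>0$ and $\tilde{\bm p}\in\mathbb U^n$, $$\mathcal L_\beta(\tilde{\bm p},\tilde{\bm q},\bm t,\bm\lambda)=f(\tilde{\bm p},\tilde{\bm q},\bm t)+g(\tilde{\bm p},\tilde{\bm q})-\langle\bm\lambda,\tilde{\bm p}-\tilde{\bm q}\rangle+\tfrac\beta2\|\tilde{\bm p}-\tilde{\bm q}\|^2,\quad \bm\lambda\in\mathbb R^{4n}.$$ PieADMM. Parameters: $\beta>0$ and symmetric positive definite block diagonal matrices $H_1,H_2$ (size $4n$, with $4\times 4$ diagonal blocks $\tau_{1,i}I_4$, respectively $\tau_{2,i}I_4$) and $H_3$ (size $3n$). From an initial point with $\tilde{\bm p},\tilde{\bm q}\in\mathbb U^n$, $\bm t\in\mathbb R^{3n}$, $\bm\lambda\in\mathbb R^{4n}$, indexed by $k=0$, iterate for $k=0,1,2,\dots$: $$\tilde{\bm p}^{k+1}\in\arg\min_{\tilde{\bm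 p}\in\mathbb U^n}\ \langle\nabla_{\tilde{\bm p}}f(\tilde{\bm p}^k,\tilde{\bm q}^k,\bm t^k)+\nabla_{\tilde{\bm p}}g(\tilde{\bm p}^k,\tilde{\bm q}^k),\tilde{\bm p}-\tilde{\bm p}^k\rangle-\langle\bm\lambda^k,\tilde{\bm p}-\tilde{\bm q}^k\rangle+\tfrac\beta2\|\tilde{\bm p}-\tilde{\bm q}^k\|^2+\tfrac12\|\tilde{\bm p}-\tilde{\bm p}^k\|_{H_1}^2,$$ $$\tilde{\bm q}^{k+1}=\arg\min_{\tilde{\bm q}\in\mathbb R^{4n}}\mathcal L_\beta(\tilde{\bm p}^{k+1},\tilde{\bm q},\bm t^k,\bm\lambda^k)+\tfrac12\|\tilde{\bm q}-\tilde{\bm q}^k\|_{H_2}^2,\qquad \bm t^{k+1}=\arg\min_{\bm t\in\mathbb R^{3n}}\mathcal L_\beta(\tilde{\bm p}^{k+1},\tilde{\bm q}^{k+1},\bm t,\bm\lambda^k)+\tfrac12\|\bm t-\bm t^k\|_{H_3}^2,$$ $$\bm\lambda^{k+1}=\bm\lambda^k-\beta(\tilde{\bm p}^{k+1}-\tilde{\bm q}^{k+1}).$$ Lipschitz constants. Since the sequence is bounded, fix bounded sets $B_p\supseteq\mathbb U^n$, $B_q$ in $\mathbb R^{4n}$ and $B_t$ in $\mathbb R^{3n}$ containing all $\tilde{\bm p}^k$, $\tilde{\bm q}^k$, $\bm t^k$ respectively. $L_f$ is a Lipschitz constant of $\nabla f$ on $B_p\times B_q\times B_t$ and $L_g$ one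 of $\nabla g$ on $B_p\times B_q$. $L_{f,\tilde{\bm p}}$ (resp. $L_{g,\tilde{\bm p}}$) is a constant such that for all $\tilde{\bm q}\in B_q$ and all $\bm t\in\mathbb R^{3n}$ the map $\tilde{\bm p}\mapsto\nabla_{\tilde{\bm p}}f(\tilde{\bm p},\tilde{\bm q},\bm t)$ (resp. $\tilde{\bm p}\mapsto\nabla_{\tilde{\bm p}}g(\tilde{\bm p},\tilde{\bm q})$) is Lipschitz on $\mathbb R^{4n}$ with that constant. $L_{f,\tilde{\bm q}}$, $L_{g,\tilde{\bm q}}$ are defined likewise with the roles of $\tilde{\bm p}$ and $\tilde{\bm q}$ exchanged (uniformly over $\tilde{\bm p}\in B_p$). Merit function. $$\Phi^k=\mathcal L_\beta(\tilde{\bm p}^k,\tilde{\bm q}^k,\bm t^k,\bm\lambda^k)+\tfrac4\beta\|H_2(\tilde{\bm q}^k-\tilde{\bm q}^{k-1})\|^2+\tfrac{4L_f^2}{\beta}\|\bm t^k-\bm t^{k-1}\|^2.$$ $\epsilon$-stationary solution. A point $(\tilde{\bm p},\tilde{\bm q},\bm t)$ is an $\epsilon$-stationary solution of the PGO model if there is a multiplier $\bm\lambda\in\mathbb R^{4n}$ such that $\operatorname{dist}\big(\operatorname{Proj}_{T_{\tilde{\bm p}}\mathbb U^n}(-\nabla_{\tilde{\bm p}}f(\tilde{\bm p},\tilde{\bm q},\bm t)-\nabla_{\tilde{\bm p}}g(\tilde{\bm p},\tilde{\bm q})+\bm\lambda),\,N_{\mathbb U^n}(\tilde{\bm p})\big)\le\epsilon$,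 $\|\nabla_{\tilde{\bm q}}f(\tilde{\bm p},\tilde{\bm q},\bm t)+\nabla_{\tilde{\bm q}}g(\tilde{\bm p},\tilde{\bm q})+\bm\lambda\|\le\epsilon$, $\|\nabla_{\bm t}f(\tilde{\bm p},\tilde{\bm q},\bm t)\|\le\epsilon$, and $\|\tilde{\bm p}-\tilde{\bm q}\|\le\epsilon$. Here $T_{\tilde{\bm p}}\mathbb U^n=\{v\in\mathbb R^{4n}: \tilde p_i^\top v_i=0\ \forall i\}$ is the tangent space, $\operatorname{Proj}$ is the orthogonal projection, and $N_{\mathbb U^n}(\tilde{\bm p})$ is the normal cone, i.e. the orthogonal complement of $T_{\tilde{\bm p}}\mathbb U^n$.
   Formalization: The bound ''k̂ is no more than T'' is replaced by k̂ ≤ max(T,1)+2 (k̂ ranging over k ≥ 2, as θ_k needs w^{k-2}), since it is false as stated: with f=g=0, n=1, λ^0=0, p^0=−q^0, β>τ_1 one gets T=0 but k̂=3 for small ε. *)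

(* Defs.v *)
From HB Require Import structures.
From mathcomp Require Import all_boot all_order all_algebra.
From mathcomp Require Import all_classical all_reals all_analysis.

Set Implicit Arguments.
Unset Strict Implicit.
Unset Printing Implicit Defensive.
Import Order.TTheory GRing.Theory Num.Theory.
Import numFieldNormedType.Exports.
Local Open Scope classical_set_scope.
Local Open Scope ring_scope.

(* The norm [`|x|] that the library puts on matrices is the sup norm, hence the
   Euclidean inner product and norm below. *)
Section Euclidean.
Variable R : realType.

Definition dot m (x y : 'rV[R]_m) : R := (x *m y^T) 0 0.
Definition sqnorm m (x : 'rV[R]_m) : R := dot x x.
Definition enorm m (x : 'rV[R]_m) : R := Num.sqrt (sqnorm x).

Definition wsqnorm m (M : 'M[R]_m) (x : 'rV[R]_m) : R := (x *m M *m x^T) 0 0.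

Definition psd m (M : 'M[R]_m) : Prop :=
  M^T = M /\ forall x : 'rV[R]_m, 0 <= wsqnorm M x.
Definition posdef m (M : 'M[R]_m) : Prop :=
  M^T = M /\ forall x : 'rV[R]_m, x != 0 -> 0 < wsqnorm M x.

Definition sigma_min m (M : 'M[R]_m) : R := inf [set a | eigenvalue M a].
Definition sigma_max m (M : 'M[R]_m) : R := sup [set a | eigenvalue M a].

Definition grad m (F : 'rV[R]_m -> R) (x : 'rV[R]_m) : 'rV[R]_m :=
  \row_j 'D_(delta_mx 0 j) F x.

Definition lipschitz_with m k (L : R) (F : 'rV[R]_m -> 'rV[R]_k) : Prop :=
  forall x y, enorm (F x - F y) <= L * enorm (x - y).

Definition is_argmin (X : Type) (A : set X) (F : X -> R) (x : X) : Prop :=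
  A x /\ forall y, A y -> F x <= F y.

Definition ortho_compl m (S : set 'rV[R]_m) : set 'rV[R]_m :=
  [set u | forall v, S v -> dot u v = 0].

(* Orthogonal projection of [v] onto a linear subspace [S]. *)
Definition orth_proj m (S : set 'rV[R]_m) (v : 'rV[R]_m) : 'rV[R]_m :=
  xget 0 [set z | S z /\ ortho_compl S (v - z)].

Definition dist m (x : 'rV[R]_m) (S : set 'rV[R]_m) : R :=
  inf [set enorm (x - u) | u in S].

End Euclidean.

Section Quaternions.
Variable R : realType.

Definition qc (a : 'rV[R]_4) (k : nat) : R := a 0 (inord k).

Definition qmk (a b c d : R) : 'rV[R]_4 := \row_i [:: a; b; c; d]`_i.

Definition qmul (a b : 'rV[R]_4) : 'rV[R]_4 :=
  qmk (qc a 0 * qc b 0 - qc a 1 * qc b 1 - qc a 2 * qc b 2 - qc a 3 * qc b 3)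
      (qc a 0 * qc b 1 + qc a 1 * qc b 0 + qc a 2 * qc b 3 - qc a 3 * qc b 2)
      (qc a 0 * qc b 2 - qc a 1 * qc b 3 + qc a 2 * qc b 0 + qc a 3 * qc b 1)
      (qc a 0 * qc b 3 + qc a 1 * qc b 2 - qc a 2 * qc b 1 + qc a 3 * qc b 0).

Definition qconj (a : 'rV[R]_4) : 'rV[R]_4 :=
  qmk (qc a 0) (- qc a 1) (- qc a 2) (- qc a 3).

Definition qone : 'rV[R]_4 := qmk 1 0 0 0.

Definition qpure (t : 'rV[R]_3) : 'rV[R]_4 := row_mx (0 : 'rV[R]_1) t.

(* A vector of R^(n m) is the concatenation of [n] blocks of length [m]; [blk]
   extracts the [i]-th one. *)
Definition blk n m (x : 'rV[R]_(n * m)) (i : 'I_n) : 'rV[R]_m :=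
  row i (vec_mx x).

Definition unitq : set 'rV[R]_4 := [set q | enorm q = 1].
Definition Un n : set 'rV[R]_(n * 4) := [set p | forall i, unitq (blk p i)].

Definition tangent n (p : 'rV[R]_(n * 4)) : set 'rV[R]_(n * 4) :=
  [set v | forall i, dot (blk p i) (blk v i) = 0].
Definition normal_cone n (p : 'rV[R]_(n * 4)) : set 'rV[R]_(n * 4) :=
  ortho_compl (tangent p).

(* The block diagonal matrix with blocks [tau i *: 1%:M] of size [m]. *)
Definition scalar_blocks n m (tau : 'I_n -> R) : 'M[R]_(n * m) :=
  diag_mx (mxvec (\matrix_(i < n, j < m) tau i)).

Definition block_diagonal n m (M : 'M[R]_(n * m)) : Prop :=
  forall (i i' : 'I_n) (j j' : 'I_m), i != i' ->
    M (mxvec_index i j) (mxvec_index i' j') = 0.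

End Quaternions.

(* The measurements are only relevant on the edges. *)
Record pgo_data (R : realType) (n : nat) := PGOData {
  edges : {set 'I_n * 'I_n};
  qmeas : 'I_n -> 'I_n -> 'rV[R]_4;
  tmeas : 'I_n -> 'I_n -> 'rV[R]_3;
  Sigma1 : 'M[R]_4;
  Sigma2 : 'M[R]_4;
  qmeas_unit : forall i j, (i, j) \in edges -> unitq (qmeas i j);
  Sigma1_psd : psd Sigma1;
  Sigma2_psd : psd Sigma2
}.

Section PGO.
Variables (R : realType) (n : nat) (D : pgo_data R n).
Implicit Types (p q lam : 'rV[R]_(n * 4)) (t : 'rV[R]_(n * 3)).

Definition pgo_f p q t : R :=
  \sum_(e in edges D)
    wsqnorm (Sigma1 D)
      (qpure (blk t e.2) - qpure (blk t e.1)
       - qmul (qmul (blk q e.1) (qpure (tmeas D e.1 e.2)))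
              (qconj (blk p e.1))).

Definition pgo_g p q : R :=
  \sum_(e in edges D)
    wsqnorm (Sigma2 D)
      (qmul (qmul (qconj (blk p e.2)) (blk q e.1)) (qmeas D e.1 e.2)
       - qone R).

Definition fstar : R :=
  inf [set pgo_f z.1.1 z.1.2 z.2 | z in
       [set z : 'rV[R]_(n * 4) * 'rV[R]_(n * 4) * 'rV[R]_(n * 3) |
         Un z.1.1]].
Definition gstar : R :=
  inf [set pgo_g z.1 z.2 | z in
       [set z : 'rV[R]_(n * 4) * 'rV[R]_(n * 4) | Un z.1]].

Definition gradp_f p q t := grad (fun x => pgo_f x q t) p.
Definition gradq_f p q t := grad (fun x => pgo_f p x t) q.
Definition gradt_f p q t := grad (fun x => pgo_f p q x) t.
Definition gradp_g p q := grad (fun x => pgo_g x q) p.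
Definition gradq_g p q := grad (fun x => pgo_g p x) q.

Definition grad_f p q t : 'rV[R]_(n * 4 + (n * 4 + n * 3)) :=
  row_mx (gradp_f p q t) (row_mx (gradq_f p q t) (gradt_f p q t)).
Definition grad_g p q : 'rV[R]_(n * 4 + n * 4) :=
  row_mx (gradp_g p q) (gradq_g p q).

Definition auglag (beta : R) p q t lam : R :=
  pgo_f p q t + pgo_g p q - dot lam (p - q) + beta / 2 * sqnorm (p - q).

Definition eps_stationary_with (eps : R) p q t lam : Prop :=
  [/\ dist (orth_proj (tangent p) (- gradp_f p q t - gradp_g p q + lam))
           (normal_cone p) <= eps,
      enorm (gradq_f p q t + gradq_g p q + lam) <= eps,
      enorm (gradt_f p q t) <= eps
    & enorm (p - q) <= eps].

Definition eps_stationary (eps : R) p q t : Prop :=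
  exists lam, eps_stationary_with eps p q t lam.

Definition pieadmm (beta : R) (H1 H2 : 'M[R]_(n * 4)) (H3 : 'M[R]_(n * 3))
    (p q : nat -> 'rV[R]_(n * 4)) (t : nat -> 'rV[R]_(n * 3))
    (lam : nat -> 'rV[R]_(n * 4)) : Prop :=
  [/\ @Un R n (p 0%N), @Un R n (q 0%N) &
   forall k : nat,
    [/\ is_argmin (@Un R n)
          (fun x => dot (gradp_f (p k) (q k) (t k) + gradp_g (p k) (q k))
                        (x - p k)
                    - dot (lam k) (x - q k) + beta / 2 * sqnorm (x - q k)
                    + 2^-1 * wsqnorm H1 (x - p k))
          (p k.+1),
        is_argmin setT
          (fun x => auglag beta (p k.+1) x (t k) (lam k)
                    + 2^-1 * wsqnorm H2 (x - q k))
          (q k.+1),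
        is_argmin setT
          (fun x => auglag beta (p k.+1) (q k.+1) x (lam k)
                    + 2^-1 * wsqnorm H3 (x - t k))
          (t k.+1)
      & lam k.+1 = lam k - beta *: (p k.+1 - q k.+1)]].

Definition lipschitz_constants (Bp Bq : set 'rV[R]_(n * 4))
    (Bt : set 'rV[R]_(n * 3)) (Lf Lg Lfp Lgp Lfq Lgq : R) : Prop :=
  (forall p q t p' q' t', Bp p -> Bq q -> Bt t -> Bp p' -> Bq q' -> Bt t' ->
     enorm (grad_f p q t - grad_f p' q' t')
     <= Lf * enorm (row_mx p (row_mx q t) - row_mx p' (row_mx q' t'))) /\
  (forall p q p' q', Bp p -> Bq q -> Bp p' -> Bq q' ->
     enorm (grad_g p q - grad_g p' q')
     <= Lg * enorm (row_mx p q - row_mx p' q')) /\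
  (forall q t, Bq q -> lipschitz_with Lfp (fun p => gradp_f p q t)) /\
  (forall q, Bq q -> lipschitz_with Lgp (fun p => gradp_g p q)) /\
  (forall p t, Bp p -> lipschitz_with Lfq (fun q => gradq_f p q t)) /\
  (forall p, Bp p -> lipschitz_with Lgq (fun q => gradq_g p q)).

Section Iterates.
Variables (p q : nat -> 'rV[R]_(n * 4)) (t : nat -> 'rV[R]_(n * 3)).

(* Meaningful for [1 <= k] only, since it involves the iterate [k - 1]. *)
Definition merit (beta Lf : R) (H2 : 'M[R]_(n * 4))
    (lam : nat -> 'rV[R]_(n * 4)) (k : nat) : R :=
  auglag beta (p k) (q k) (t k) (lam k)
  + 4 / beta * sqnorm ((q k - q k.-1) *m H2^T)
  + 4 * Lf ^+ 2 / beta * sqnorm (t k - t k.-1).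

Definition witer (k : nat) : 'rV[R]_(n * 4 + (n * 4 + n * 3)) :=
  row_mx (p k) (row_mx (q k) (t k)).

(* Meaningful for [2 <= k] only, since it involves the iterate [k - 2]; moreover
   [theta 2] involves the step from the arbitrary initial point to the first
   iterate, which [merit 1] does not control. *)
Definition theta (k : nat) : R :=
  sqnorm (witer k - witer k.-1) + sqnorm (witer k.-1 - witer k.-2).

End Iterates.

End PGO.

(* Main.v *)
(* Each block of variables enters [f] and [g] through affine residuals, so [f] and
   [g] are exactly quadratic in each block.  The optimality condition of the [q]
   step expresses the multiplier through gradients at the iterates, so that
   [|lam (k+1) - lam k|^2] is bounded by the last two steps; the decrease of the
   Lagrangian in the [p], [q], [t] steps outweighs its increase in the [lam] step,
   and the merit function decreases by at least [nu] times the squared step.  As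
   the merit function is bounded below by [fstar + gstar], the squared steps are
   summable and some small [theta k] occurs early.  On the product of spheres the
   proximal terms of the [p] step are affine, hence its optimality condition says
   that the gradient of the subproblem is normal to the spheres; comparing the
   optimality conditions of the subproblems with those of the model leaves
   residuals bounded by steps. *)

Require Import Defs.
From HB Require Import structures.
From mathcomp Require Import all_boot all_order all_algebra.
From mathcomp Require Import all_classical all_reals all_analysis.
From mathcomp Require Import ring lra.

Set Implicit Arguments.
Unset Strict Implicit.
Unset Printing Implicit Defensive.
Import Order.TTheory GRing.Theory Num.Theory.
Import numFieldNormedType.Exports.
Local Open Scope classical_set_scope.
Local Open Scope ring_scope.

(** * Euclidean inner product and quadratic forms on row vectors *)

Section InnerProduct.
Variable R : realType.

Lemma dotE m (x y : 'rV[R]_m) : dot x y = \sum_j x 0 j * y 0 j.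
Proof. by rewrite /dot mxE; apply: eq_bigr => j _; rewrite mxE. Qed.

Lemma dotC m (x y : 'rV[R]_m) : dot x y = dot y x.
Proof. by rewrite !dotE; apply: eq_bigr => j _; rewrite mulrC. Qed.

Lemma dotDl m (x y z : 'rV[R]_m) : dot (x + y) z = dot x z + dot y z.
Proof. by rewrite /dot mulmxDl mxE. Qed.

Lemma dotNl m (x z : 'rV[R]_m) : dot (- x) z = - dot x z.
Proof. by rewrite /dot mulNmx mxE. Qed.

Lemma dotZl m a (x z : 'rV[R]_m) : dot (a *: x) z = a * dot x z.
Proof. by rewrite /dot -scalemxAl mxE. Qed.

Lemma dot0l m (z : 'rV[R]_m) : dot 0 z = 0.
Proof. by rewrite /dot mul0mx mxE. Qed.

Lemma dotDr m (x y z : 'rV[R]_m) : dot z (x + y) = dot z x + dot z y.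
Proof. by rewrite dotC dotDl !(dotC z). Qed.

Lemma dotNr m (x z : 'rV[R]_m) : dot z (- x) = - dot z x.
Proof. by rewrite dotC dotNl (dotC z). Qed.

Lemma dotZr m a (x z : 'rV[R]_m) : dot z (a *: x) = a * dot z x.
Proof. by rewrite dotC dotZl (dotC z). Qed.

Lemma dot0r m (z : 'rV[R]_m) : dot z 0 = 0.
Proof. by rewrite dotC dot0l. Qed.

Definition dot_lin :=
  (dotDl, dotDr, dotNl, dotNr, dotZl, dotZr, dot0l, dot0r).

Lemma sqnorm_ge0 m (x : 'rV[R]_m) : 0 <= sqnorm x.
Proof. by rewrite /sqnorm dotE sumr_ge0 // => j _; rewrite -expr2 sqr_ge0. Qed.

Lemma sqnorm_eq0 m (x : 'rV[R]_m) : (sqnorm x == 0) = (x == 0).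
Proof.
apply/eqP/eqP => [|->]; last by rewrite /sqnorm dot0l.
rewrite /sqnorm dotE => /psumr_eq0P x0; apply/rowP => j; rewrite mxE.
by apply/eqP; rewrite -sqrf_eq0 expr2 x0 // => i _; rewrite -expr2 sqr_ge0.
Qed.

Lemma sqnorm_gt0 m (x : 'rV[R]_m) : (0 < sqnorm x) = (x != 0).
Proof. by rewrite lt_def sqnorm_ge0 sqnorm_eq0 andbT. Qed.

Lemma sqnormN m (x : 'rV[R]_m) : sqnorm (- x) = sqnorm x.
Proof. by rewrite /sqnorm !dot_lin opprK. Qed.

Lemma sqnormZ m a (x : 'rV[R]_m) : sqnorm (a *: x) = a ^+ 2 * sqnorm x.
Proof. by rewrite /sqnorm !dot_lin; ring. Qed.

Lemma sqnormD_le m (x y : 'rV[R]_m) :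
  sqnorm (x + y) <= 2 * sqnorm x + 2 * sqnorm y.
Proof.
have := sqnorm_ge0 (x - y).
by rewrite /sqnorm !dot_lin (dotC y x); lra.
Qed.

Lemma enorm_ge0 m (x : 'rV[R]_m) : 0 <= enorm x.
Proof. exact: sqrtr_ge0. Qed.

Lemma enorm_sqr m (x : 'rV[R]_m) : enorm x ^+ 2 = sqnorm x.
Proof. by rewrite sqr_sqrtr // sqnorm_ge0. Qed.

Lemma enormN m (x : 'rV[R]_m) : enorm (- x) = enorm x.
Proof. by rewrite /enorm sqnormN. Qed.

Lemma enormZ m a (x : 'rV[R]_m) : enorm (a *: x) = `|a| * enorm x.
Proof. by rewrite /enorm sqnormZ sqrtrM ?sqr_ge0 // sqrtr_sqr. Qed.

Lemma enorm_le m (x : 'rV[R]_m) c : 0 <= c -> (enorm x <= c) = (sqnorm x <= c ^+ 2).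
Proof. by move=> c0; rewrite -enorm_sqr ler_sqr // nnegrE enorm_ge0. Qed.

Lemma wsqnormE m (M : 'M[R]_m) x : wsqnorm M x = dot (x *m M) x.
Proof. by []. Qed.

Lemma wsqnormZ m (M : 'M[R]_m) a x : wsqnorm M (a *: x) = a ^+ 2 * wsqnorm M x.
Proof. by rewrite !wsqnormE -scalemxAl !dot_lin; ring. Qed.

Lemma dot_mulmx m k (M : 'M[R]_(m, k)) x y : dot (x *m M) y = dot x (y *m M^T).
Proof. by rewrite /dot trmx_mul trmxK mulmxA. Qed.

Lemma dot_mulmx_sym m (M : 'M[R]_m) x y : M^T = M ->
  dot (x *m M) y = dot (y *m M) x.
Proof. by move=> Msym; rewrite dot_mulmx Msym dotC. Qed.

Lemma wsqnormD m (M : 'M[R]_m) x y : M^T = M ->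
  wsqnorm M (x + y) = wsqnorm M x + 2 * dot (x *m M) y + wsqnorm M y.
Proof.
by move=> Msym; rewrite !wsqnormE mulmxDl !dot_lin (dot_mulmx_sym y x Msym); ring.
Qed.

Lemma sqnormD m (x y : 'rV[R]_m) :
  sqnorm (x + y) = sqnorm x + 2 * dot x y + sqnorm y.
Proof. by rewrite /sqnorm !dot_lin (dotC y x); ring. Qed.

(* The discriminant argument in the form that also handles degenerate [M]. *)
Lemma psd_cauchy_schwarz m (M : 'M[R]_m) : M^T = M ->
  (forall x : 'rV[R]_m, 0 <= wsqnorm M x) ->
  forall x y, dot (x *m M) y ^+ 2 <= wsqnorm M x * wsqnorm M y.
Proof.
move=> Msym Mpsd x y.
set a := wsqnorm M x; set b := dot _ _; set c := wsqnorm M y.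
have exp s r : 0 <= s ^+ 2 * a + 2 * s * r * b + r ^+ 2 * c.
  have := Mpsd (s *: x + r *: y).
  rewrite wsqnormD // -scalemxAl dotZl dotZr !wsqnormZ -/a -/b -/c.
  by congr (_ <= _); ring.
have a0 : 0 <= a by exact: Mpsd.
have c0 : 0 <= c by exact: Mpsd.
have [a_eq0|a_neq0] := eqVneq a 0.
  (* With [a = 0], taking [s = - (c + 1) / 2] and [r = b] turns the form into [- b ^+ 2], so [b]
     vanishes. *)
  have := exp (- (c + 1)) b; have := exp (- (c + 1) / 2) b.
  by rewrite a_eq0; nra.
have a_gt0 : 0 < a by rewrite lt_def a_neq0.
(* The minimizing ratio of [s] to [r] is [- b / a]; scaling by [a] avoids the division. *)
have := exp (- b) a.
have -> : (- b) ^+ 2 * a + 2 * - b * a * b + a ^+ 2 * c = a * (a * c - b ^+ 2).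
  by ring.
by rewrite pmulr_rge0 // subr_ge0.
Qed.

Lemma wsqnorm1 m (x : 'rV[R]_m) : wsqnorm 1%:M x = sqnorm x.
Proof. by rewrite /wsqnorm mulmx1. Qed.

Lemma cauchy_schwarz m (x y : 'rV[R]_m) : dot x y <= enorm x * enorm y.
Proof.
have := @psd_cauchy_schwarz m 1%:M (trmx1 _ _) _ x y.
rewrite !wsqnorm1 mulmx1 => /(_ (fun z => _)) H.
have {}H : dot x y ^+ 2 <= sqnorm x * sqnorm y.
  by apply: H => z; rewrite wsqnorm1 sqnorm_ge0.
rewrite (le_trans (ler_norm _)) // -ler_sqr ?nnegrE ?mulr_ge0 ?enorm_ge0 //.
by rewrite real_normK ?num_real // exprMn !enorm_sqr.
Qed.

Lemma enormD m (x y : 'rV[R]_m) : enorm (x + y) <= enorm x + enorm y.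
Proof.
rewrite enorm_le ?addr_ge0 ?enorm_ge0 // sqrrD !enorm_sqr.
by rewrite sqnormD; have := cauchy_schwarz x y; lra.
Qed.

Lemma sqnorm_row_mx m1 m2 (x : 'rV[R]_m1) (y : 'rV[R]_m2) :
  sqnorm (row_mx x y) = sqnorm x + sqnorm y.
Proof. by rewrite /sqnorm /dot tr_row_mx mul_row_col mxE. Qed.

Lemma enorm_row_mxl m1 m2 (x : 'rV[R]_m1) (y : 'rV[R]_m2) :
  enorm x <= enorm (row_mx x y).
Proof.
by rewrite enorm_le ?enorm_ge0 // enorm_sqr sqnorm_row_mx lerDl sqnorm_ge0.
Qed.

Lemma enorm_row_mxr m1 m2 (x : 'rV[R]_m1) (y : 'rV[R]_m2) :
  enorm y <= enorm (row_mx x y).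
Proof.
by rewrite enorm_le ?enorm_ge0 // enorm_sqr sqnorm_row_mx lerDr sqnorm_ge0.
Qed.

End InnerProduct.

(** * Extreme eigenvalues of symmetric matrices via Rayleigh quotients *)

Section Spectrum.
Variable R : realType.

Lemma wsqnormN m (M : 'M[R]_m) x : wsqnorm (- M) x = - wsqnorm M x.
Proof. by rewrite !wsqnormE mulmxN dotNl. Qed.

Lemma dot_continuous m (f g : 'rV[R]_m -> 'rV[R]_m) :
  (forall j, continuous (fun x => f x 0 j)) ->
  (forall j, continuous (fun x => g x 0 j)) ->
  continuous (fun x => dot (f x) (g x)).
Proof.
move=> fc gc; under eq_fun do rewrite dotE.
apply: continuous_big; first exact: add_continuous.
move=> j _ x.
by apply: continuousM; [exact: fc | exact: gc].
Qed.

Lemma wsqnorm_continuous m (M : 'M[R]_m) : continuous (wsqnorm M).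
Proof.
apply: dot_continuous => j; last exact: coord_continuous.
under eq_fun do rewrite mxE.
apply: continuous_big; first exact: add_continuous.
move=> i _ x.
by apply: continuousM; [exact: coord_continuous | exact: cst_continuous].
Qed.

Lemma compact_sphere m : compact [set x : 'rV[R]_m | sqnorm x = 1].
Proof.
apply: bounded_closed_compact.
  exists 1; split; first exact: num_real.
  move=> b b1 x /= x1; rewrite (le_trans _ (ltW b1)) //.
  rewrite /Num.norm /= mx_normrE; apply: bigmax_le => // -[i j] _ /=.
  rewrite ord1 -[leRHS]gtr0_norm // -ler_sqr ?nnegrE // !real_normK ?num_real //.
  rewrite expr1n -x1 /sqnorm dotE (bigD1 j) //= -expr2 lerDl sumr_ge0 // => k _.
  by rewrite -expr2 sqr_ge0.
have -> : [set x : 'rV[R]_m | sqnorm x = 1] = sqnorm (m:=m) @^-1` [set 1 : R].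
  by apply/seteqP; split.
apply: preimage_closed; last exact: closed_eq.
by move=> x _; apply: dot_continuous => j; exact: coord_continuous.
Qed.

(** Cauchy-Schwarz for the form [M] at [x] and [x *m M]: the left side is the square of
    [sqnorm (x *m M)], the right side vanishes. *)
Lemma psd_null m (M : 'M[R]_m) x : M^T = M ->
  (forall y : 'rV[R]_m, 0 <= wsqnorm M y) -> wsqnorm M x = 0 -> x *m M = 0.
Proof.
move=> Msym Mpsd x0; apply/eqP; rewrite -sqnorm_eq0.
have := psd_cauchy_schwarz Msym Mpsd x (x *m M).
by rewrite x0 mul0r -/(sqnorm _) => H; rewrite -sqrf_eq0 eq_le H sqr_ge0.
Qed.

(* [x] minimizes the Rayleigh quotient over the (compact) unit sphere. *)
Lemma rayleigh_min m (M : 'M[R]_m) : (0 < m)%N -> M^T = M ->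
  exists x : 'rV[R]_m, exists a : R, [/\ x != 0, x *m M = a *: x &
    forall y, a * sqnorm y <= wsqnorm M y].
Proof.
move=> m_gt0 Msym.
have [||x /set_mem /= x1 xmin] :=
  compact_EVT_min _ (@compact_sphere m) (f := wsqnorm M).
- exists (delta_mx 0 (Ordinal m_gt0)) => /=.
  rewrite /sqnorm dotE (bigD1 (Ordinal m_gt0)) //= big1 ?addr0 => [|j jN].
    by rewrite mxE !eqxx mulr1.
  by rewrite mxE (negPf jN) andbF mulr0.
- by apply: continuous_subspaceT; exact: wsqnorm_continuous.
have xN0 : x != 0 by rewrite -sqnorm_eq0 x1 oner_eq0.
have lower y : wsqnorm M x * sqnorm y <= wsqnorm M y.
  have [->|yN0] := eqVneq y 0.
    by rewrite [leRHS]wsqnormE /sqnorm !dot0r mulr0.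
  have y_gt0 : 0 < sqnorm y by rewrite sqnorm_gt0.
  have := xmin ((enorm y)^-1 *: y); rewrite wsqnormZ exprVn enorm_sqr.
  rewrite mulrC ler_pdivlMr //; apply; apply/mem_set => /=.
  by rewrite sqnormZ exprVn enorm_sqr mulVf // gt_eqF.
exists x, (wsqnorm M x); split => //.
(* [x] is a zero of the positive semidefinite form obtained by subtracting the minimum from [M],
   hence in its kernel: an eigenvector without Lagrange multipliers. *)
apply/eqP; rewrite -subr_eq0 -mul_mx_scalar -mulmxBr; apply/eqP; apply: psd_null.
- by rewrite raddfB /= Msym tr_scalar_mx.
- move=> y; have := lower y.
  by rewrite !wsqnormE mulmxBr dotDl dotNl mul_mx_scalar dotZl subr_ge0.
- rewrite !wsqnormE mulmxBr dotDl dotNl mul_mx_scalar dotZl -/(sqnorm x) x1.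
  by rewrite mulr1 subrr.
Qed.

Lemma eigenvalue_ge m (M : 'M[R]_m) a b :
  (forall y, a * sqnorm y <= wsqnorm M y) -> eigenvalue M b -> a <= b.
Proof.
move=> lower /eigenvalueP [v vM vN0]; have := lower v.
by rewrite wsqnormE vM dotZl ler_pM2r // sqnorm_gt0.
Qed.

(** The Rayleigh minimum is an eigenvalue and a lower bound for all of them, so the infimum defining
    [sigma_min] is attained. *)
Lemma sigma_min_spec m (M : 'M[R]_m) : (0 < m)%N -> M^T = M ->
  exists x : 'rV[R]_m, [/\ x != 0, x *m M = sigma_min M *: x &
    forall y, sigma_min M * sqnorm y <= wsqnorm M y].
Proof.
move=> m_gt0 Msym; have [x [a [xN0 xM lower]]] := rayleigh_min m_gt0 Msym.
suff -> : sigma_min M = a by exists x.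
have ea : eigenvalue M a by apply/eigenvalueP; exists x.
have lba : lbound [set b | eigenvalue M b] a by move=> b; exact: eigenvalue_ge.
by apply/le_anti/andP; split; [apply: ge_inf => //; exists a |
  apply: lb_le_inf => //; exists a].
Qed.

(** The Rayleigh minimum of [- M], negated, is an eigenvalue of [M] that bounds its quotient from
    above. *)
Lemma sigma_max_ge m (M : 'M[R]_m) y : (0 < m)%N -> M^T = M ->
  wsqnorm M y <= sigma_max M * sqnorm y.
Proof.
move=> m_gt0 Msym.
have [|x [a [xN0 xM lower]]] := @rayleigh_min _ (- M) m_gt0.
  by rewrite linearN /= Msym.
have upper z : wsqnorm M z <= - a * sqnorm z.
  by rewrite mulNr lerNr -wsqnormN lower.
apply: (le_trans (upper y)); rewrite ler_wpM2r ?sqnorm_ge0 //.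
have xaM : x *m M = - a *: x by rewrite scaleNr -xM mulmxN opprK.
apply: ub_le_sup; last by apply/eigenvalueP; exists x.
exists (- a) => b /= /eigenvalueP [v vM vN0]; have := upper v.
by rewrite wsqnormE vM dotZl ler_pM2r // sqnorm_gt0.
Qed.

Lemma posdef_sigma_min_gt0 m (M : 'M[R]_m) : (0 < m)%N -> posdef M ->
  0 < sigma_min M.
Proof.
move=> m_gt0 [Msym Mpos]; have [x [xN0 xM _]] := sigma_min_spec m_gt0 Msym.
by have := Mpos x xN0; rewrite wsqnormE xM dotZl pmulr_lgt0 // sqnorm_gt0.
Qed.

Lemma sigma_min_gt m (M : 'M[R]_m) a : (0 < m)%N -> M^T = M ->
  posdef (M - a%:M) -> a < sigma_min M.
Proof.
move=> m_gt0 Msym [_ Mpos]; have [x [xN0 xM _]] := sigma_min_spec m_gt0 Msym.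
have := Mpos x xN0.
rewrite wsqnormE mulmxBr xM mul_mx_scalar -scalerBl dotZl pmulr_lgt0 ?subr_gt0 //.
by rewrite sqnorm_gt0.
Qed.

Lemma sigma_min_le_max m (M : 'M[R]_m) : (0 < m)%N -> M^T = M ->
  sigma_min M <= sigma_max M.
Proof.
move=> m_gt0 Msym; have [x [xN0 _ lower]] := sigma_min_spec m_gt0 Msym.
have := le_trans (lower x) (sigma_max_ge x m_gt0 Msym).
by rewrite ler_pM2r // sqnorm_gt0.
Qed.

Lemma posdef_sigma_max_gt0 m (M : 'M[R]_m) : (0 < m)%N -> posdef M ->
  0 < sigma_max M.
Proof.
move=> m_gt0 Mpos; apply: lt_le_trans (sigma_min_le_max m_gt0 _).
  exact: posdef_sigma_min_gt0.
by case: Mpos.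
Qed.

Lemma posdef_ge0 m (M : 'M[R]_m) x : posdef M -> 0 <= wsqnorm M x.
Proof.
move=> [_ Mpos]; have [->|/Mpos/ltW //] := eqVneq x 0.
by rewrite wsqnormE dot0r.
Qed.

(* Cauchy-Schwarz for the form [M], applied to [x] and [x *m M]. *)
Lemma sqnorm_mulmx_le m (M : 'M[R]_m) x : (0 < m)%N -> posdef M ->
  sqnorm (x *m M) <= sigma_max M ^+ 2 * sqnorm x.
Proof.
move=> m_gt0 Mpos; have Msym : M^T = M by case: Mpos.
have [->|xM0] := eqVneq (x *m M) 0.
  by rewrite /sqnorm dot0l mulr_ge0 ?sqr_ge0 ?sqnorm_ge0.
have s_gt0 := posdef_sigma_max_gt0 m_gt0 Mpos.
have := psd_cauchy_schwarz Msym (fun y => posdef_ge0 y Mpos) x (x *m M).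
rewrite -/(sqnorm _) => cs.
have yy_gt0 : 0 < sqnorm (x *m M) by rewrite sqnorm_gt0.
rewrite -(ler_pM2r yy_gt0) -expr2 (le_trans cs) //.
have h1 := sigma_max_ge x m_gt0 Msym.
have h2 := sigma_max_ge (x *m M) m_gt0 Msym.
rewrite (le_trans (ler_pM _ _ h1 h2)) ?posdef_ge0 //.
by rewrite le_eqVlt; apply/orP; left; apply/eqP; ring.
Qed.

End Spectrum.

(** * Quadratic functions: exact expansions, gradients and minimizers *)

Section Quadratic.
Variable R : realType.

Definition affine m k (u : 'rV[R]_m -> 'rV[R]_k) :=
  exists (A : 'M[R]_(m, k)) (r : 'rV[R]_k), forall x, u x = r + x *m A.

Lemma affine_cst m k (r : 'rV[R]_k) : affine (fun _ : 'rV[R]_m => r).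
Proof. by exists 0, r => x; rewrite mulmx0 addr0. Qed.

Lemma affine_id m : affine (@id 'rV[R]_m).
Proof. by exists 1%:M, 0 => x; rewrite mulmx1 add0r. Qed.

Lemma affineB m k (u v : 'rV[R]_m -> 'rV[R]_k) :
  affine u -> affine v -> affine (fun x => u x - v x).
Proof.
move=> [A [r uE]] [B [s vE]]; exists (A - B), (r - s) => x.
by rewrite uE vE mulmxBr opprD addrACA.
Qed.

Lemma affine_comp m k l (v : 'rV[R]_k -> 'rV[R]_l) (u : 'rV[R]_m -> 'rV[R]_k) :
  affine v -> affine u -> affine (fun x => v (u x)).
Proof.
move=> [B [s vE]] [A [r uE]]; exists (A *m B), (s + r *m B) => x.
by rewrite vE uE mulmxDl mulmxA addrA.
Qed.

Lemma linear_affine m k (u : 'rV[R]_m -> 'rV[R]_k) : linear u -> affine u.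
Proof.
move=> lin_u; exists (lin1_mx u), 0 => x; rewrite add0r.
pose L := GRing.isLinear.Build R 'rV[R]_m 'rV[R]_k *:%R u lin_u.
pose uL : {linear 'rV[R]_m -> 'rV[R]_k} := HB.pack u L.
by rewrite (mul_rV_lin1 uL).
Qed.

(** An exact second-order expansion with gradient [a] and one [M] for all points; the symmetric part
    of [M] is half the Hessian. *)
Definition quadratic_with m (F : 'rV[R]_m -> R) a (M : 'M[R]_m) :=
  forall x h, F (x + h) = F x + dot (a x) h + wsqnorm M h.

Definition quadratic m (F : 'rV[R]_m -> R) := exists a M, quadratic_with F a M.

Lemma quadratic0 m : quadratic (fun _ : 'rV[R]_m => 0).
Proof.
exists (fun=> 0), 0 => x h.
by rewrite wsqnormE mulmx0 !dot0l !addr0.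
Qed.

Lemma quadraticD m (F G : 'rV[R]_m -> R) :
  quadratic F -> quadratic G -> quadratic (fun x => F x + G x).
Proof.
move=> [a [M FE]] [b [N GE]]; exists (fun x => a x + b x), (M + N) => x h.
by rewrite FE GE !wsqnormE mulmxDr !dotDl; ring.
Qed.

Lemma quadratic_sum m (I : Type) (r : seq I) (P : pred I)
    (F : I -> 'rV[R]_m -> R) :
  (forall i, quadratic (F i)) -> quadratic (fun x => \sum_(i <- r | P i) F i x).
Proof.
move=> Fq; elim: r => [|i r IHr].
  by under [X in quadratic X]eq_fun do rewrite big_nil; exact: quadratic0.
under [X in quadratic X]eq_fun do rewrite big_cons.
by case: (P i) => //; exact: quadraticD.
Qed.

Lemma quadratic_wsqnorm m k (S : 'M[R]_k) (u : 'rV[R]_m -> 'rV[R]_k) :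
  S^T = S -> affine u -> quadratic (fun x => wsqnorm S (u x)).
Proof.
move=> Ssym [A [r uE]].
exists (fun x => 2 *: (u x *m S *m A^T)), (A *m S *m A^T) => x h.
have -> : u (x + h) = u x + h *m A by rewrite !uE mulmxDl addrA.
have -> : wsqnorm (A *m S *m A^T) h = wsqnorm S (h *m A).
  by rewrite !wsqnormE !mulmxA dot_mulmx trmxK.
by rewrite wsqnormD // dotZl [in RHS]dot_mulmx trmxK.
Qed.

(** Along a basis vector the difference quotient is exactly [a x 0 j] plus a multiple of the
    increment, so its limit is immediate. *)
Lemma quadratic_grad m (F : 'rV[R]_m -> R) a M :
  quadratic_with F a M -> grad F = a.
Proof.
move=> FE; apply/funext => x; apply/rowP => j; rewrite mxE.
have -> : a x 0 j = dot (a x) (delta_mx 0 j).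
  rewrite dotE (bigD1 j) //= big1 ?addr0 => [|i iN].
    by rewrite mxE !eqxx mulr1.
  by rewrite mxE (negPf iN) andbF mulr0.
set v := delta_mx 0 j; apply/cvg_lim => //.
have lim_b : (fun h : R => dot (a x) v + h * wsqnorm M v) @ 0^' --> dot (a x) v.
  rewrite -[X in _ --> X]addr0 -[X in _ --> _ + X](mul0r (wsqnorm M v)).
  apply: cvgD; first exact: cvg_cst.
  by apply: cvgM; [exact: nbhs_dnbhs | exact: cvg_cst].
apply: cvg_trans lim_b; apply: near_eq_cvg.
near=> h.
have h0 : h != 0 by near: h; exact: nbhs_dnbhs_neq.
rewrite /= (addrC (h *: v) x) FE dotZr wsqnormZ /GRing.scale /=.
by field.
Unshelve. all: by end_near. Qed.

Lemma quadratic_expand m (F : 'rV[R]_m -> R) : quadratic F ->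
  exists M, quadratic_with F (grad F) M.
Proof. by move=> [a [M FE]]; exists M; rewrite (quadratic_grad FE). Qed.

(* Adding the exact expansions at [x] and at [x + h] gives
   [2 wsqnorm M h = dot (grad F (x + h) - grad F x) h]. *)
Lemma quadratic_descent m (F : 'rV[R]_m -> R) L x h :
  quadratic F -> lipschitz_with L (grad F) ->
  F (x + h) <= F x + dot (grad F x) h + L / 2 * sqnorm h.
Proof.
move=> /quadratic_expand [M FE] lipF.
have e1 := FE x h; have := FE (x + h) (- h); rewrite addrK dotNr.
have -> : wsqnorm M (- h) = wsqnorm M h by rewrite -scaleN1r wsqnormZ; ring.
move=> e2.
have := cauchy_schwarz (grad F (x + h) - grad F x) h; rewrite dotDl dotNl.
have : enorm (grad F (x + h) - grad F x) * enorm h <= L * sqnorm h.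
  rewrite -enorm_sqr expr2 mulrA ler_wpM2r ?enorm_ge0 //.
  by have := lipF (x + h) x; rewrite (addrC x h) addrK.
by lra.
Qed.

(** A first-order condition with the remainder kept exactly: testing along multiples of [a]
    suffices. *)
Lemma fermat_quadratic m (a : 'rV[R]_m) (Q : 'rV[R]_m -> R) :
  (forall s h, Q (s *: h) = s ^+ 2 * Q h) ->
  (forall h, 0 <= dot a h + Q h) -> a = 0.
Proof.
move=> QZ ge0; apply/eqP; rewrite -sqnorm_eq0.
set A := sqnorm a; set B := Q a.
have ge0s s : 0 <= s * A + s ^+ 2 * B.
  by have := ge0 (s *: a); rewrite dotZr QZ.
have A0 : 0 <= A by exact: sqnorm_ge0.
have B0 : 0 <= B by have := ge0s (-1); lra.
have c0 : B + 1 != 0 by rewrite gt_eqF // ltr_wpDl.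
(* This [s] makes the expression minus a square; the [+ 1] keeps the denominator nonzero when
   [B = 0]. *)
have := ge0s (- A / (B + 1)).
have -> : - A / (B + 1) * A + (- A / (B + 1)) ^+ 2 * B = - (A / (B + 1)) ^+ 2.
  by field.
rewrite oppr_ge0 => le0.
have : (A / (B + 1)) ^+ 2 == 0 by rewrite eq_le le0 sqr_ge0.
by rewrite sqrf_eq0 mulf_eq0 invr_eq0 (negPf c0) orbF.
Qed.

End Quadratic.

(** * Real-linearity of the quaternion operations *)

Section QuaternionMaps.
Variable R : realType.

Lemma blk_linear n m (i : 'I_n) : linear (fun x : 'rV[R]_(n * m) => blk x i).
Proof. by move=> a x y; apply/rowP => j; rewrite !mxE. Qed.

Lemma qpure_linear : linear (@qpure R).
Proof.
move=> a x y; apply/rowP => j; rewrite !mxE.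
by case: splitP => k _; rewrite !mxE // mulr0 addr0.
Qed.

Lemma qconj_linear : linear (@qconj R).
Proof.
move=> a x y; apply/rowP => -[[|[|[|[|//]]]] ?]; rewrite !mxE /= /qc !mxE; ring.
Qed.

Lemma qmul_linearl b : linear (fun a : 'rV[R]_4 => qmul a b).
Proof.
move=> a x y; apply/rowP => -[[|[|[|[|//]]]] ?]; rewrite !mxE /= /qc !mxE; ring.
Qed.

Lemma qmul_linearr b : linear (@qmul R b).
Proof.
move=> a x y; apply/rowP => -[[|[|[|[|//]]]] ?]; rewrite !mxE /= /qc !mxE; ring.
Qed.

End QuaternionMaps.

(** * Blockwise quadratic structure and lower bounds of [pgo_f] and [pgo_g] *)

Section PGOQuadratic.
Variables (R : realType) (n : nat) (D : pgo_data R n).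
Implicit Types (p q : 'rV[R]_(n * 4)) (t : 'rV[R]_(n * 3)).

Let affine_blk m i k (u : 'rV[R]_m -> 'rV[R]_(n * k)) :
  affine u -> affine (fun x => blk (u x) i).
Proof. by apply: (affine_comp (linear_affine (@blk_linear R n k i))). Qed.

Let affine_qpure m (u : 'rV[R]_m -> 'rV[R]_3) :
  affine u -> affine (fun x => qpure (u x)).
Proof. by apply: affine_comp; apply: linear_affine; exact: qpure_linear. Qed.

Let affine_qconj m (u : 'rV[R]_m -> 'rV[R]_4) :
  affine u -> affine (fun x => qconj (u x)).
Proof. by apply: affine_comp; apply: linear_affine; exact: qconj_linear. Qed.

Let affine_qmull m (u : 'rV[R]_m -> 'rV[R]_4) b :
  affine u -> affine (fun x => qmul (u x) b).
Proof. by apply: (affine_comp (linear_affine (@qmul_linearl R b))). Qed.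

Let affine_qmulr m (u : 'rV[R]_m -> 'rV[R]_4) b :
  affine u -> affine (fun x => qmul b (u x)).
Proof. by apply: affine_comp; apply: linear_affine; exact: qmul_linearr. Qed.

(** Conjugation is real-linear and the product is linear in each factor, so a residual is affine in
    one block of variables once the others are fixed. Jointly it contains products of [p] and [q],
    hence one lemma per block. *)
Lemma pgo_f_quadratic_p q t : quadratic (fun p => pgo_f D p q t).
Proof.
apply: quadratic_sum => e; apply: quadratic_wsqnorm.
  by case: (Sigma1_psd D).
apply: affineB; first exact: affine_cst.
by apply/affine_qmulr/affine_qconj/affine_blk/affine_id.
Qed.

Lemma pgo_f_quadratic_q p t : quadratic (fun q => pgo_f D p q t).
Proof.
apply: quadratic_sum => e; apply: quadratic_wsqnorm.
  by case: (Sigma1_psd D).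
apply: affineB; first exact: affine_cst.
by apply/affine_qmull/affine_qmull/affine_blk/affine_id.
Qed.

Lemma pgo_f_quadratic_t p q : quadratic (pgo_f D p q).
Proof.
apply: quadratic_sum => e; apply: quadratic_wsqnorm.
  by case: (Sigma1_psd D).
apply: affineB; last exact: affine_cst.
by apply: affineB; apply/affine_qpure/affine_blk/affine_id.
Qed.

Lemma pgo_g_quadratic_p q : quadratic (fun p => pgo_g D p q).
Proof.
apply: quadratic_sum => e; apply: quadratic_wsqnorm.
  by case: (Sigma2_psd D).
apply: affineB; last exact: affine_cst.
by apply/affine_qmull/affine_qmull/affine_qconj/affine_blk/affine_id.
Qed.

Lemma pgo_g_quadratic_q p : quadratic (pgo_g D p).
Proof.
apply: quadratic_sum => e; apply: quadratic_wsqnorm.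
  by case: (Sigma2_psd D).
apply: affineB; last exact: affine_cst.
by apply/affine_qmull/affine_qmulr/affine_blk/affine_id.
Qed.

Lemma pgo_f_ge0 p q t : 0 <= pgo_f D p q t.
Proof. by apply: sumr_ge0 => e _; case: (Sigma1_psd D). Qed.

Lemma pgo_g_ge0 p q : 0 <= pgo_g D p q.
Proof. by apply: sumr_ge0 => e _; case: (Sigma2_psd D). Qed.

(** [inf] is a lower bound only for sets that are bounded below, here by [0]. *)
Lemma fstar_le p q t : Un p -> fstar D <= pgo_f D p q t.
Proof.
move=> pU; apply: ge_inf; last by exists (p, q, t).
by exists 0 => _ [z _ <-]; exact: pgo_f_ge0.
Qed.

Lemma gstar_le p q : Un p -> gstar D <= pgo_g D p q.
Proof.
move=> pU; apply: ge_inf; last by exists (p, q).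
by exists 0 => _ [z _ <-]; exact: pgo_g_ge0.
Qed.

End PGOQuadratic.

(** * First-order conditions on the product of unit spheres *)

Section Spheres.
Variables (R : realType) (n : nat).

Lemma dot_blk m (x y : 'rV[R]_(n * m)) :
  dot x y = \sum_(i < n) dot (blk x i) (blk y i).
Proof.
rewrite dotE (reindex _ (curry_mxvec_bij n m)) /=.
under [RHS]eq_bigr do rewrite dotE.
rewrite [RHS]pair_bigA; apply: eq_bigr => -[i j] _ /=.
by rewrite -(vec_mxK x) -(vec_mxK y) !mxvecE /blk !mxvecK !mxE.
Qed.

Lemma blk_scalar_blocks m (tau : 'I_n -> R) (x : 'rV[R]_(n * m)) i :
  blk (x *m scalar_blocks m tau) i = tau i *: blk x i.
Proof.
by apply/rowP => j; rewrite /scalar_blocks mul_mx_diag !mxE mxvecE mxE mulrC.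
Qed.

Lemma blk_mxvec m (f : 'I_n -> 'rV[R]_m) i : blk (mxvec (\matrix_k f k)) i = f i.
Proof. by rewrite /blk mxvecK rowK. Qed.

Lemma blkB m (x y : 'rV[R]_(n * m)) i : blk (x - y) i = blk x i - blk y i.
Proof. by apply/rowP => j; rewrite !mxE. Qed.

Lemma unitq_sqnorm (u : 'rV[R]_4) : unitq u -> sqnorm u = 1.
Proof. by rewrite /unitq /= -enorm_sqr => ->; rewrite expr1n. Qed.

Lemma unitq_scale (c : 'rV[R]_4) : c != 0 -> unitq ((enorm c)^-1 *: c).
Proof.
move=> cN0; have c_gt0 : 0 < sqnorm c by rewrite sqnorm_gt0.
rewrite /unitq /= /enorm sqnormZ exprVn enorm_sqr mulVf ?gt_eqF //.
exact: sqrtr1.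
Qed.

(* The minimum of [dot c] over the unit sphere is [- enorm c], attained only at
   [- c / enorm c]. *)
Lemma unitq_min (c u v : 'rV[R]_4) : unitq u ->
  (forall y, unitq y -> dot c u <= dot c y) -> dot u v = 0 -> dot c v = 0.
Proof.
move=> uU umin uv0; have [->|cN0] := eqVneq c 0; first exact: dot0l.
have := umin (- ((enorm c)^-1 *: c)).
have c_gt0 : 0 < enorm c.
  by rewrite lt_def enorm_ge0 andbT -sqrf_eq0 enorm_sqr sqnorm_eq0.
rewrite !dot_lin -/(sqnorm c) -enorm_sqr expr2 mulKf ?gt_eqF // => cu.
have {}cu : dot c u <= - enorm c.
  by apply: cu; rewrite /unitq /= enormN; exact: unitq_scale.
have : sqnorm (c + enorm c *: u) <= 0.
  rewrite /sqnorm !dot_lin (dotC u c) -!/(sqnorm _) (unitq_sqnorm uU) -enorm_sqr.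
  by nra.
rewrite le_eqVlt ltNge sqnorm_ge0 orbF sqnorm_eq0 addr_eq0 => /eqP ->.
by rewrite !dot_lin uv0 mulr0 oppr0.
Qed.

(** The functional is a sum over blocks, so the minimizer can be tested by changing one block at a
    time, which reduces to a single sphere. *)
Lemma Un_min (c u v : 'rV[R]_(n * 4)) : Un u ->
  (forall x, Un x -> dot c u <= dot c x) -> tangent u v -> dot c v = 0.
Proof.
move=> uU umin uv0; rewrite dot_blk big1 // => i _.
apply: (unitq_min (uU i)) (uv0 i) => y yU.
pose x := mxvec (\matrix_k (if k == i then y else blk u k)).
have xU : Un x by move=> k; rewrite blk_mxvec; case: eqP.
have := umin x xU.
rewrite !dot_blk (bigD1 i) //= [leRHS](bigD1 i) //= blk_mxvec eqxx.
under [X in _ + X <= _ -> _]eq_bigr => k kN.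
  have -> : blk u k = blk x k by rewrite blk_mxvec (negPf kN).
  over.
by rewrite lerD2r.
Qed.

(** Both sides equal [2 - 2 * dot u x]: between unit vectors a squared distance is affine in [x]. *)
Lemma dot_sub_unitq (x u : 'rV[R]_4) : unitq x -> unitq u ->
  sqnorm (x - u) = - 2 * dot u (x - u).
Proof.
move=> /unitq_sqnorm xU /unitq_sqnorm uU.
rewrite /sqnorm !dot_lin (dotC x u) -!/(sqnorm _) xU uU; ring.
Qed.

(** A scalar weight on each block lets the single-sphere identity be applied block by block. *)
Lemma wsqnorm_sub_Un tau (x u : 'rV[R]_(n * 4)) : Un x -> Un u ->
  wsqnorm (scalar_blocks 4 tau) (x - u)
  = - 2 * dot (u *m scalar_blocks 4 tau) (x - u).
Proof.
move=> xU uU; rewrite wsqnormE !dot_blk mulr_sumr; apply: eq_bigr => i _.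
rewrite !blk_scalar_blocks !dotZl blkB -/(sqnorm _) dot_sub_unitq //; ring.
Qed.

Lemma sqnorm_sub_Un (x u : 'rV[R]_(n * 4)) : Un x -> Un u ->
  sqnorm (x - u) = - 2 * dot u (x - u).
Proof.
move=> xU uU; rewrite /sqnorm !dot_blk mulr_sumr; apply: eq_bigr => i _.
by rewrite blkB -/(sqnorm _) dot_sub_unitq.
Qed.

(* On the product of spheres the proximal terms are affine, so the minimizer
   minimizes a linear functional. *)
Lemma Un_prox_min (beta : R) tau (G lam a b u : 'rV[R]_(n * 4)) :
  let H := scalar_blocks 4 tau in
  is_argmin (@Un R n)
    (fun x => dot G (x - a) - dot lam (x - b) + beta / 2 * sqnorm (x - b)
              + 2^-1 * wsqnorm H (x - a)) u ->
  forall v, tangent u v ->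
    dot (G - lam + beta *: (u - b) + (u - a) *m H) v = 0.
Proof.
move=> H [uU umin] v uv; set A := G - lam + _ + _.
(* On the product of spheres the objective is [dot c] plus a constant; the terms taken off [A] are
   normal to the spheres at [u], so [A] and [c] agree on tangent vectors. *)
pose c := A - beta *: u - u *m H.
have -> : dot A v = dot c v + beta * dot u v + dot (u *m H) v.
  by rewrite /c !dot_lin; ring.
have -> : dot u v = 0 by rewrite dot_blk big1.
have -> : dot (u *m H) v = 0.
  by rewrite dot_blk big1 // => i _; rewrite blk_scalar_blocks dotZl uv mulr0.
rewrite mulr0 !addr0; apply: Un_min (uU) _ uv => x xU.
have Hsym : H^T = H by rewrite /H /scalar_blocks tr_diag_mx.
have := umin x xU.
have xE y : x - y = (u - y) + (x - u) by rewrite [RHS]addrC subrKA.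
rewrite (xE a) (xE b) (sqnormD (u - b)) (wsqnormD (u - a)) //.
rewrite (sqnorm_sub_Un xU uU) (wsqnorm_sub_Un tau xU uU) -/H.
rewrite /c /A !dot_lin; lra.
Qed.

(** [orth_proj] is a choice with default [0], so a projection has to be exhibited: remove from each
    block of [w] its component along the unit vector [blk u i]. *)
Lemma orth_proj_tangent (u w : 'rV[R]_(n * 4)) : Un u ->
  let z := orth_proj (tangent u) w in
  tangent u z /\ ortho_compl (tangent u) (w - z).
Proof.
move=> uU; rewrite /orth_proj.
set P := [set z | _]; apply: (@xgetPex _ 0 P).
pose s i := dot (blk u i) (blk w i).
pose r := mxvec (\matrix_i (s i *: blk u i)).
exists (w - r); split => [i|v uv].
  rewrite blkB blk_mxvec !dot_lin -/(sqnorm _) (unitq_sqnorm (uU i)).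
  by rewrite mulr1 subrr.
rewrite opprB addrC subrK dot_blk big1 // => i _.
by rewrite blk_mxvec dotZl uv mulr0.
Qed.

(** The cone contains [0], so the distance is at most [enorm z]. As [A] is normal, [sqnorm z] equals
    [dot (w + A) z], and Cauchy-Schwarz concludes. *)
Lemma dist_normal_cone_le (u w A : 'rV[R]_(n * 4)) : Un u ->
  (forall v, tangent u v -> dot A v = 0) ->
  dist (orth_proj (tangent u) w) (normal_cone u) <= enorm (w + A).
Proof.
move=> uU A0; have [zT wz] := orth_proj_tangent w uU.
set z := orth_proj _ _ in zT wz *.
apply: (@le_trans _ _ (enorm z)).
  apply: ge_inf; first by exists 0 => _ [y _ <-]; exact: enorm_ge0.
  by exists 0; rewrite ?subr0 // => y _; exact: dot0l.
have : dot (w + A) z = sqnorm z.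
  have := wz z zT; rewrite !dot_lin A0 // addr0 => /eqP.
  by rewrite subr_eq0 => /eqP.
have := cauchy_schwarz (w + A) z => + E; rewrite E -enorm_sqr.
have := enorm_ge0 z; rewrite le_eqVlt => /predU1P [<- _|z_gt0].
  exact: enorm_ge0.
by rewrite expr2 ler_pM2r.
Qed.

End Spheres.

(** * Proximal steps and the augmented Lagrangian *)

Section AugmentedLagrangian.
Variable R : realType.

(** The factor [4] comes from [sqnormD_le] at two levels: split off the [h] terms, then split each
    part. *)
Lemma sqnorm_diff3_le m (F G h F' G' h' : 'rV[R]_m) :
  sqnorm (F + G + h - (F' + G' + h')) <=
  4 * sqnorm (F - F') + 4 * sqnorm (G - G') + 4 * sqnorm h + 4 * sqnorm h'.
Proof.
rewrite !opprD addrACA (addrACA F).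
have := sqnormD_le (F - F' + (G - G')) (h - h').
have := sqnormD_le (F - F') (G - G').
by have := sqnormD_le h (- h'); rewrite sqnormN; lra.
Qed.

(** The increment of the objective at [x1] is a linear term plus a form homogeneous of degree two,
    so [fermat_quadratic] kills the linear part. *)
Lemma prox_opt m (F : 'rV[R]_m -> R) a M (H : 'M[R]_m) x0 x1 :
  H^T = H -> quadratic_with F a M ->
  is_argmin setT (fun x => F x + 2^-1 * wsqnorm H (x - x0)) x1 ->
  a x1 + (x1 - x0) *m H = 0.
Proof.
move=> Hsym FE [_ x1min].
apply: (@fermat_quadratic _ _ _ (fun h => wsqnorm M h + 2^-1 * wsqnorm H h)).
  by move=> s h; rewrite !wsqnormZ; ring.
move=> h; have := x1min (x1 + h) I.
by rewrite FE [x1 + h - x0]addrAC (wsqnormD (x1 - x0)) // dotDl; lra.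
Qed.

Variables (n : nat) (D : pgo_data R n).
Implicit Types (p q lam : 'rV[R]_(n * 4)) (t : 'rV[R]_(n * 3)).

Lemma auglag_quadratic_q beta p t lam : exists M,
  quadratic_with (fun q => auglag D beta p q t lam)
    (fun q => gradq_f D p q t + gradq_g D p q + lam - beta *: (p - q)) M.
Proof.
have [Mf fE] := quadratic_expand (pgo_f_quadratic_q D p t).
have [Mg gE] := quadratic_expand (pgo_g_quadratic_q D p).
exists (Mf + Mg + (beta / 2)%:M) => q h.
have -> : wsqnorm (Mf + Mg + (beta / 2)%:M) h =
    wsqnorm Mf h + wsqnorm Mg h + beta / 2 * sqnorm h.
  by rewrite !wsqnormE !mulmxDr mul_mx_scalar !dotDl dotZl.
have pqE : p - (q + h) = p - q - h by rewrite opprD addrA.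
rewrite /auglag fE gE pqE (sqnormD (p - q)) sqnormN.
rewrite -/(gradq_f D p q t) -/(gradq_g D p q) !dot_lin.
move: (pgo_f _ _ _ _) (pgo_g _ _ _) (gradq_f _ _ _ _) (gradq_g _ _ _) => *; lra.
Qed.

Lemma auglag_quadratic_t beta p q lam : exists M,
  quadratic_with (fun t => auglag D beta p q t lam) (gradt_f D p q) M.
Proof.
have [Mf fE] := quadratic_expand (pgo_f_quadratic_t D p q).
by exists Mf => t h; rewrite /auglag fE /gradt_f; ring.
Qed.



End AugmentedLagrangian.

(** * Optimality conditions of the PieADMM steps *)

Section PieADMM.
Variables (R : realType) (n : nat) (D : pgo_data R n).
Variables (beta : R) (tau1 : 'I_n -> R).
Variables (H2 : 'M[R]_(n * 4)) (H3 : 'M[R]_(n * 3)).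
Variables (p q lam : nat -> 'rV[R]_(n * 4)) (t : nat -> 'rV[R]_(n * 3)).
Variables (Bp Bq : set 'rV[R]_(n * 4)) (Bt : set 'rV[R]_(n * 3)).
Variables (Lf Lg Lfp Lgp Lfq Lgq : R).
Let H1 := scalar_blocks 4 tau1.
Hypothesis n_gt0 : (0 < n)%N.
Hypothesis beta_gt0 : 0 < beta.
Hypothesis H1pos : posdef H1.
Hypothesis H2pos : posdef H2.
Hypothesis H3pos : posdef H3.
Hypothesis iter : pieadmm D beta H1 H2 H3 p q t lam.
Hypothesis pB : forall k, Bp (p k).
Hypothesis qB : forall k, Bq (q k).
Hypothesis tB : forall k, Bt (t k).
Hypothesis Lf_gt0 : 0 < Lf.
Hypothesis Lg_gt0 : 0 < Lg.
Hypothesis lip : lipschitz_constants D Bp Bq Bt Lf Lg Lfp Lgp Lfq Lgq.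

Let n4_gt0 : (0 < n * 4)%N. Proof. by rewrite muln_gt0 n_gt0. Qed.
Let n3_gt0 : (0 < n * 3)%N. Proof. by rewrite muln_gt0 n_gt0. Qed.

Let w := witer p q t.
Let dp k := sqnorm (p k.+1 - p k).
Let dq k := sqnorm (q k.+1 - q k).
Let dt k := sqnorm (t k.+1 - t k).

Let iter_Un k : Un (p k).
Proof. by case: iter => p0 _ step; case: k => // k; case: (step k) => -[]. Qed.

Let iter_lam k : beta *: (p k.+1 - q k.+1) = lam k - lam k.+1.
Proof.
by case: iter => _ _ /(_ k) [_ _ _ ->]; rewrite opprB addrCA subrr addr0.
Qed.

Lemma witerB k l :
  w k - w l = row_mx (p k - p l) (row_mx (q k - q l) (t k - t l)).
Proof. by rewrite /w /witer !opp_row_mx !add_row_mx. Qed.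

Lemma sqnorm_witer_step k : sqnorm (w k.+1 - w k) = dp k + dq k + dt k.
Proof. by rewrite witerB !sqnorm_row_mx addrA. Qed.

Lemma opt_p k v : tangent (p k.+1) v ->
  dot (gradp_f D (p k) (q k) (t k) + gradp_g D (p k) (q k) - lam k
       + beta *: (p k.+1 - q k) + (p k.+1 - p k) *m H1) v = 0.
Proof. by case: iter => _ _ /(_ k) [pmin _ _ _]; exact: Un_prox_min pmin v. Qed.

(** The multiplier update absorbs the penalty term, so the new multiplier stands alone. The gradient
    of [pgo_f] sits at the old [t k], since [t] is updated after [q]; this lag is the source of the
    [t] terms below. *)
Lemma opt_q k :
  lam k.+1 = - (gradq_f D (p k.+1) (q k.+1) (t k)
                + gradq_g D (p k.+1) (q k.+1) + (q k.+1 - q k) *m H2).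
Proof.
case: iter => _ _ /(_ k) [_ qmin _ _].
have [M LE] := auglag_quadratic_q D beta (p k.+1) (t k) (lam k).
case: (H2pos) => H2sym _; have := prox_opt H2sym LE qmin.
rewrite iter_lam => E; apply/eqP; rewrite -subr_eq0 opprK; apply/eqP.
by rewrite -[RHS]E; apply/rowP => j; rewrite !mxE; ring.
Qed.

Lemma opt_t k : gradt_f D (p k.+1) (q k.+1) (t k.+1) = - ((t k.+1 - t k) *m H3).
Proof.
case: iter => _ _ /(_ k) [_ _ tmin _].
have [M LE] := auglag_quadratic_t D beta (p k.+1) (q k.+1) (lam k).
case: (H3pos) => H3sym _; have := prox_opt H3sym LE tmin.
by move=> /eqP; rewrite addr_eq0 => /eqP.
Qed.

(** * Lipschitz bounds for gradient blocks and for the multiplier *)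

Lemma lip_grad_f i j k i' j' k' :
  enorm (grad_f D (p i) (q j) (t k) - grad_f D (p i') (q j') (t k'))
  <= Lf * enorm (row_mx (p i - p i') (row_mx (q j - q j') (t k - t k'))).
Proof.
case: lip => /(_ _ _ _ _ _ _ (pB i) (qB j) (tB k) (pB i') (qB j') (tB k')) + _.
by rewrite !opp_row_mx !add_row_mx.
Qed.

Lemma lip_grad_g i j i' j' :
  enorm (grad_g D (p i) (q j) - grad_g D (p i') (q j'))
  <= Lg * enorm (row_mx (p i - p i') (q j - q j')).
Proof.
case: lip => _ [/(_ _ _ _ _ (pB i) (qB j) (pB i') (qB j')) + _].
by rewrite !opp_row_mx !add_row_mx.
Qed.

Let gradBE_f i j k i' j' k' :
  grad_f D (p i) (q j) (t k) - grad_f D (p i') (q j') (t k')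
  = row_mx (gradp_f D (p i) (q j) (t k) - gradp_f D (p i') (q j') (t k'))
     (row_mx (gradq_f D (p i) (q j) (t k) - gradq_f D (p i') (q j') (t k'))
        (gradt_f D (p i) (q j) (t k) - gradt_f D (p i') (q j') (t k'))).
Proof. by rewrite /grad_f !opp_row_mx !add_row_mx. Qed.

Let gradBE_g i j i' j' :
  grad_g D (p i) (q j) - grad_g D (p i') (q j')
  = row_mx (gradp_g D (p i) (q j) - gradp_g D (p i') (q j'))
      (gradq_g D (p i) (q j) - gradq_g D (p i') (q j')).
Proof. by rewrite /grad_g !opp_row_mx !add_row_mx. Qed.

Lemma lip_gradp_f i j k i' j' k' :
  enorm (gradp_f D (p i) (q j) (t k) - gradp_f D (p i') (q j') (t k'))
  <= Lf * enorm (row_mx (p i - p i') (row_mx (q j - q j') (t k - t k'))).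
Proof.
by apply: le_trans (lip_grad_f _ _ _ _ _ _); rewrite gradBE_f enorm_row_mxl.
Qed.

Lemma lip_gradp_g i j i' j' :
  enorm (gradp_g D (p i) (q j) - gradp_g D (p i') (q j'))
  <= Lg * enorm (row_mx (p i - p i') (q j - q j')).
Proof.
by apply: le_trans (lip_grad_g _ _ _ _); rewrite gradBE_g enorm_row_mxl.
Qed.

Lemma lip_gradq_f i j k i' j' k' :
  sqnorm (gradq_f D (p i) (q j) (t k) - gradq_f D (p i') (q j') (t k'))
  <= Lf ^+ 2 * (sqnorm (p i - p i') + sqnorm (q j - q j') + sqnorm (t k - t k')).
Proof.
rewrite -addrA -!sqnorm_row_mx -enorm_sqr -[X in _ * X]enorm_sqr -exprMn.
rewrite ler_sqr ?nnegrE ?mulr_ge0 ?enorm_ge0 ?(ltW Lf_gt0) //.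
apply: le_trans (lip_grad_f _ _ _ _ _ _); rewrite gradBE_f.
exact: le_trans (enorm_row_mxl _ _) (enorm_row_mxr _ _).
Qed.

Lemma lip_gradq_g i j i' j' :
  sqnorm (gradq_g D (p i) (q j) - gradq_g D (p i') (q j'))
  <= Lg ^+ 2 * (sqnorm (p i - p i') + sqnorm (q j - q j')).
Proof.
rewrite -!sqnorm_row_mx -enorm_sqr -[X in _ * X]enorm_sqr -exprMn.
rewrite ler_sqr ?nnegrE ?mulr_ge0 ?enorm_ge0 ?(ltW Lg_gt0) //.
by apply: le_trans (lip_grad_g _ _ _ _); rewrite gradBE_g enorm_row_mxr.
Qed.

Let sqH2 x : sqnorm (x *m H2) <= sigma_max H2 ^+ 2 * sqnorm x.
Proof. exact: sqnorm_mulmx_le. Qed.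

(* [opt_q] expresses [lam] through the gradients in [q], which are Lipschitz. *)
Lemma lam_step k : sqnorm (lam k.+2 - lam k.+1) <=
  4 * (Lf ^+ 2 + Lg ^+ 2) * (dp k.+1 + dq k.+1) + 4 * Lf ^+ 2 * dt k
  + 4 * sqnorm ((q k.+2 - q k.+1) *m H2) + 4 * sqnorm ((q k.+1 - q k) *m H2).
Proof.
(* The [t] arguments lag by one index, whence [dt k] in place of [dt k.+1]. *)
rewrite !opt_q -opprD sqnormN; apply: le_trans (sqnorm_diff3_le _ _ _ _ _ _) _.
have scalar (F G S2 S1 x y z : R) :
    F <= Lf ^+ 2 * (x + y + z) -> G <= Lg ^+ 2 * (x + y) ->
    4 * F + 4 * G + 4 * S2 + 4 * S1 <=
    4 * (Lf ^+ 2 + Lg ^+ 2) * (x + y) + 4 * Lf ^+ 2 * z + 4 * S2 + 4 * S1.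
  by lra.
exact: scalar (lip_gradq_f _ _ _ _ _ _) (lip_gradq_g _ _ _ _).
Qed.

(** * Decrease and lower bound of the merit function *)

Lemma lam_step_constraint k :
  sqnorm (lam k.+1 - lam k) = beta ^+ 2 * sqnorm (p k.+1 - q k.+1).
Proof. by rewrite -sqnormN opprB -iter_lam sqnormZ. Qed.

(** The minimizer is compared with [p k], where the linearized and proximal terms vanish. The
    proximal term gains half of [sigma_min H1]; replacing the linearization by [pgo_f] and [pgo_g]
    costs half of [Lfp + Lgp], by [quadratic_descent]. *)
Lemma descent_p k :
  auglag D beta (p k.+1) (q k) (t k) (lam k)
  <= auglag D beta (p k) (q k) (t k) (lam k)
     - 2^-1 * (sigma_min H1 - Lfp - Lgp) * dp k.
Proof.
case: iter => _ _ /(_ k) [[_ /(_ (p k) (iter_Un k)) pmin] _ _ _].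
have [H1sym _] := H1pos.
have [_ [_ _ lower]] := sigma_min_spec n4_gt0 H1sym.
have [_ [_ [Lp [Gp _]]]] := lip.
have := quadratic_descent (p k) (p k.+1 - p k)
  (pgo_f_quadratic_p D (q k) (t k)) (Lp _ (t k) (qB k)).
have := quadratic_descent (p k) (p k.+1 - p k)
  (pgo_g_quadratic_p D (q k)) (Gp _ (qB k)).
have := lower (p k.+1 - p k).
move: pmin; rewrite subrr wsqnormE !dot0r !dotDl -wsqnormE.
have -> : p k + (p k.+1 - p k) = p k.+1 by rewrite addrC subrK.
rewrite /auglag /gradp_f /gradp_g -/(dp k) [wsqnorm H1 0]wsqnormE dot0r.
move: (grad _ _) (grad _ _) (pgo_f D (p k.+1) _ _) (pgo_f D (p k) _ _)
  (pgo_g D (p k.+1) _) (pgo_g D (p k) _) (sigma_min H1).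
move: (wsqnorm H1 (p k.+1 - p k)) (dp k) (sqnorm (p k.+1 - q k))
  (sqnorm (p k - q k)) => W d s1 s0 gg gf f1 f0 g1 g0 s.
rewrite !dot_lin; lra.
Qed.

(** The competitor [q k] has zero proximal term, so the decrease is at least the proximal term at
    the minimizer; [t] is treated alike. *)
Lemma descent_q k :
  auglag D beta (p k.+1) (q k.+1) (t k) (lam k)
  <= auglag D beta (p k.+1) (q k) (t k) (lam k) - 2^-1 * sigma_min H2 * dq k.
Proof.
case: iter => _ _ /(_ k) [_ [_ /(_ (q k) I) qmin] _ _].
have [H2sym _] := H2pos.
have [_ [_ _ /(_ (q k.+1 - q k)) lower]] := sigma_min_spec n4_gt0 H2sym.
move: qmin; rewrite subrr [wsqnorm H2 0]wsqnormE dot0r /dq; lra.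
Qed.

Lemma descent_t k :
  auglag D beta (p k.+1) (q k.+1) (t k.+1) (lam k)
  <= auglag D beta (p k.+1) (q k.+1) (t k) (lam k) - 2^-1 * sigma_min H3 * dt k.
Proof.
case: iter => _ _ /(_ k) [_ _ [_ /(_ (t k) I) tmin] _].
have [H3sym _] := H3pos.
have [_ [_ _ /(_ (t k.+1 - t k)) lower]] := sigma_min_spec n3_gt0 H3sym.
move: tmin; rewrite subrr [wsqnorm H3 0]wsqnormE dot0r /dt; lra.
Qed.

(** The change is [- dot (lam k.+1 - lam k) (p k.+1 - q k.+1)], and by the update the gap is the
    multiplier step divided by [- beta]. *)
Lemma auglag_lam k :
  auglag D beta (p k.+1) (q k.+1) (t k.+1) (lam k.+1)
  = auglag D beta (p k.+1) (q k.+1) (t k.+1) (lam k)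
    + beta^-1 * sqnorm (lam k.+1 - lam k).
Proof.
rewrite lam_step_constraint expr2 -mulrA mulKf ?gt_eqF //.
have -> : lam k.+1 = lam k - beta *: (p k.+1 - q k.+1).
  by rewrite iter_lam opprB addrCA subrr addr0.
rewrite /auglag /sqnorm; set d := p k.+1 - q k.+1; rewrite dotDl dotNl dotZl; ring.
Qed.

Let nu :=
  Num.min (2^-1 * (sigma_min H1 - Lfp - Lgp) - 4 / beta * (Lf ^+ 2 + Lg ^+ 2))
    (Num.min (2^-1 * sigma_min H2 - 4 / beta * (Lf ^+ 2 + Lg ^+ 2)
                - 8 / beta * sigma_max H2 ^+ 2)
             (2^-1 * sigma_min H3 - 4 / beta * Lf ^+ 2)).

Let nu_le1 : nu <= 2^-1 * (sigma_min H1 - Lfp - Lgp)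
                   - 4 / beta * (Lf ^+ 2 + Lg ^+ 2).
Proof. by rewrite /nu ge_min lexx. Qed.

Let nu_le2 : nu <= 2^-1 * sigma_min H2 - 4 / beta * (Lf ^+ 2 + Lg ^+ 2)
                   - 8 / beta * sigma_max H2 ^+ 2.
Proof. by rewrite /nu !ge_min lexx !orbT. Qed.

Let nu_le3 : nu <= 2^-1 * sigma_min H3 - 4 / beta * Lf ^+ 2.
Proof. by rewrite /nu !ge_min lexx !orbT. Qed.

(** The increase due to the multiplier is bounded by [lam_step]. Its terms in the previous step
    cancel against the extra terms of [merit] at [k.+1]; those of [merit] at [k.+2] add to the cost,
    which explains [8 / beta] for [H2] and [4 / beta * Lf ^+ 2] for [t] in [nu]. *)
Lemma merit_decrease k :
  nu * sqnorm (w k.+2 - w k.+1)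
  <= merit D p q t beta Lf H2 lam k.+1 - merit D p q t beta Lf H2 lam k.+2.
Proof.
rewrite sqnorm_witer_step /merit /= (auglag_lam k.+1).
have [-> _] := H2pos.
have := descent_p k.+1; have := descent_q k.+1; have := descent_t k.+1.
have : beta^-1 * sqnorm (lam k.+2 - lam k.+1) <= beta^-1 * _ :=
  ler_wpM2l (ltW (eqbRL (invr_gt0 _) beta_gt0)) (lam_step k).
have : beta^-1 * sqnorm ((q k.+2 - q k.+1) *m H2) <= beta^-1 * _ :=
  ler_wpM2l (ltW (eqbRL (invr_gt0 _) beta_gt0)) (sqH2 (q k.+2 - q k.+1)).
have := ler_wpM2r (sqnorm_ge0 (p k.+2 - p k.+1)) nu_le1.
have := ler_wpM2r (sqnorm_ge0 (q k.+2 - q k.+1)) nu_le2.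
have := ler_wpM2r (sqnorm_ge0 (t k.+2 - t k.+1)) nu_le3.
rewrite -/(dp k.+1) -/(dq k.+1) -/(dt k.+1) -/(dt k).
move: (dp k.+1) (dq k.+1) (dt k.+1) (dt k) (sqnorm (lam _ - lam _))
  (sqnorm ((q k.+2 - q k.+1) *m _)) (sqnorm ((q k.+1 - q k) *m _)).
move: (auglag _ _ _ _ _ _) (auglag _ _ _ _ _ _) (auglag _ _ _ _ _ _)
  (auglag _ _ _ _ _ _).
move: (nu) (sigma_min H1) (sigma_min H2) (sigma_min H3) (sigma_max H2).
by move: (beta^-1) => *; lra.
Qed.

Hypothesis beta_gt : 4 / 3 * (Lfq + Lgq) < beta.

(* By the expression of [lam k] and the descent lemma in [q], the value of the
   Lagrangian dominates [f + g] at the feasible point [(p k, p k, t k)]. *)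
Lemma merit_lower k : fstar D + gstar D <= merit D p q t beta Lf H2 lam k.+1.
Proof.
set P := p k.+1; set Q := q k.+1; set d := P - Q.
have [_ [_ [_ [_ [Lq Gq]]]]] := lip.
have := quadratic_descent Q d (pgo_f_quadratic_q D P (t k.+1))
  (Lq _ (t k.+1) (pB k.+1)).
have := quadratic_descent Q d (pgo_g_quadratic_q D P) (Gq _ (pB k.+1)).
rewrite [Q + d]addrC subrK -/(gradq_f D P Q (t k.+1)) -/(gradq_g D P Q).
have := fstar_le D P (t k.+1) (iter_Un k.+1).
have := gstar_le D P (iter_Un k.+1).
rewrite /merit /= (proj1 H2pos) /auglag -/P -/Q -/d opt_q -/P -/Q.
(* [h] and [F1 - F0] separate [- lam k.+1] from the gradient at the current point; the two extra
   terms of [merit] are sized to absorb them. *)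
set h := (Q - q k) *m H2; set s := t k.+1 - t k.
set F1 := gradq_f D P Q (t k.+1); set F0 := gradq_f D P Q (t k).
have F10 : sqnorm (F1 - F0) <= Lf ^+ 2 * sqnorm s.
  have := lip_gradq_f k.+1 k.+1 k.+1 k.+1 k.+1 k.
  by rewrite (subrr (p _)) (subrr (q _)) [sqnorm 0]dot0l !add0r.
(* AM-GM: the two cross terms cost [beta / 8 * sqnorm d] in total; the remaining
   [3 / 8 * beta] dominates [(Lfq + Lgq) / 2], whence the constant [4 / 3]. *)
have amgm (x : 'rV[R]_(n * 4)) :
    0 <= dot x d + 4 / beta * sqnorm x + beta / 16 * sqnorm d.
  have := sqnorm_ge0 (x + (beta / 8) *: d).
  rewrite sqnormD dotZr sqnormZ => ge0.
  have -> : dot x d + 4 / beta * sqnorm x + beta / 16 * sqnorm d =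
    4 / beta * (sqnorm x + 2 * (beta / 8 * dot x d) + (beta / 8) ^+ 2 * sqnorm d).
    by field; rewrite gt_eqF.
  by rewrite mulr_ge0 // divr_ge0 // ltW.
have := amgm (- (F1 - F0)); rewrite dotNl sqnormN.
have := amgm h.
have : 4 / beta * sqnorm (F1 - F0) <= 4 / beta * (Lf ^+ 2 * sqnorm s).
  by rewrite ler_wpM2l // divr_ge0 // ltW.
have : 4 / 3 * (Lfq + Lgq) * sqnorm d <= beta * sqnorm d.
  by rewrite ler_wpM2r ?sqnorm_ge0 // ltW.
rewrite (dotDl F1) (dotNl F0) (dotNl (F0 + _ + _)) (dotDl (F0 + _)) (dotDl F0).
have scalar (fs gs fP gP fQ gQ f1 f0 g1 hd sF sh ss sd b : R) :
    4 / 3 * (Lfq + Lgq) * sd <= beta * sd ->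
    4 * b * sF <= 4 * b * (Lf ^+ 2 * ss) ->
    0 <= hd + 4 * b * sh + beta / 16 * sd ->
    0 <= - (f1 - f0) + 4 * b * sF + beta / 16 * sd ->
    gs <= gP -> fs <= fP -> gP <= gQ + g1 + Lgq / 2 * sd ->
    fP <= fQ + f1 + Lfq / 2 * sd ->
    fs + gs <= fQ + gQ - - (f0 + g1 + hd) + beta / 2 * sd + 4 * b * sh
               + 4 * Lf ^+ 2 * b * ss.
  by lra.
exact: scalar.
Qed.

Lemma merit_telescope N :
  nu * \sum_(k < N) sqnorm (w k.+2 - w k.+1)
  <= merit D p q t beta Lf H2 lam 1 - merit D p q t beta Lf H2 lam N.+1.
Proof.
elim: N => [|N IHN]; first by rewrite big_ord0 mulr0 subrr.
rewrite big_ord_recr mulrDr /=.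
by rewrite (le_trans (lerD IHN (merit_decrease N))) // addrA subrK.
Qed.

Lemma thetaE k : theta p q t k.+2 =
  sqnorm (w k.+2 - w k.+1) + sqnorm (w k.+1 - w k).
Proof. by []. Qed.

(* [theta 2] is excluded from the sum: the first step is not controlled by the
   merit function. *)
Lemma theta_small delta N : 0 < nu -> 0 < delta -> (0 < N)%N ->
  2 / (nu * delta) * (merit D p q t beta Lf H2 lam 1 - fstar D - gstar D) <= N%:R ->
  exists2 k, (2 <= k <= N.+2)%N & theta p q t k <= delta.
Proof.
move=> nu_gt0 delta_gt0 N_gt0 leN; apply: contrapT => no_small.
have big k : (k < N)%N -> delta < theta p q t k.+3.
  by move=> kN; rewrite ltNge; apply/negP => ?; apply: no_small; exists k.+3.
pose s k := sqnorm (w k.+2 - w k.+1).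
have s_ge0 k : 0 <= s k by exact: sqnorm_ge0.
(* Strictness requires a summand, provided by [0 < N]. *)
have sum_gt : delta * N%:R < \sum_(k < N) theta p q t k.+3.
  rewrite mulr_natr -[X in _ *+ X]card_ord -sumr_const.
  apply: ltr_sum; last by move=> k _; exact: big.
  by apply/hasP; exists (Ordinal N_gt0); rewrite ?mem_index_enum.
(* The [N] values of [theta] from index 3 on involve the steps [s 0] to [s N], each at most
   twice. *)
have sum_le : \sum_(k < N) theta p q t k.+3 <= 2 * \sum_(k < N.+1) s k.
  under eq_bigr do rewrite thetaE -!/(s _).
  rewrite big_split /= mulr2n mulrDl !mul1r lerD //.
    by rewrite [leRHS]big_ord_recl lerDr.
  by rewrite [leRHS]big_ord_recr lerDl.
have tele := merit_telescope N.+1; have low := merit_lower N.+1.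
move: leN; rewrite -mulrA mulrCA ler_pdivrMl ?mulr_gt0 // => leN.
have := lt_le_trans sum_gt sum_le; rewrite -(ltr_pM2l nu_gt0) => gt.
have scalar (m1 m2 f g x S : R) :
    2 * (m1 - f - g) <= nu * delta * x -> nu * S <= m1 - m2 -> f + g <= m2 ->
    nu * (delta * x) < nu * (2 * S) -> False.
  by lra.
exact: scalar leN tele low gt.
Qed.

(** * Residuals of the stationarity conditions *)

Let s1_ge0 : 0 <= sigma_max H1.
Proof. exact: ltW (posdef_sigma_max_gt0 n4_gt0 H1pos). Qed.

(** Up to sign the gap is the multiplier step divided by [beta], and [lam_step] bounds it by two
    consecutive steps; this is why [theta] adds two of them. *)
Lemma stationary_feasibility k : sqnorm (p k.+2 - q k.+2) <=
  4 / beta ^+ 2 * (Lf ^+ 2 + Lg ^+ 2 + sigma_max H2 ^+ 2) * theta p q t k.+2.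
Proof.
rewrite -(ler_pM2l (exprn_gt0 2 beta_gt0)) -lam_step_constraint.
have -> K x : beta ^+ 2 * (4 / beta ^+ 2 * K * x) = K * x * 4.
  by field; rewrite gt_eqF.
apply: le_trans (lam_step k) _.
rewrite thetaE !sqnorm_witer_step.
have := sqH2 (q k.+2 - q k.+1); have := sqH2 (q k.+1 - q k).
rewrite -/(dq k.+1) -/(dq k).
have scalar (x2 y2 z2 x1 y1 z1 S2 S1 s : R) :
    0 <= x2 -> 0 <= y2 -> 0 <= z2 -> 0 <= x1 -> 0 <= y1 -> 0 <= z1 ->
    S1 <= s ^+ 2 * y1 -> S2 <= s ^+ 2 * y2 ->
    4 * (Lf ^+ 2 + Lg ^+ 2) * (x2 + y2) + 4 * Lf ^+ 2 * z1 + 4 * S2 + 4 * S1 <=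
    (Lf ^+ 2 + Lg ^+ 2 + s ^+ 2) * (x2 + y2 + z2 + (x1 + y1 + z1)) * 4.
  have := sqr_ge0 Lf; have := sqr_ge0 Lg; have := sqr_ge0 s; nra.
by apply: scalar; exact: sqnorm_ge0.
Qed.

Lemma stationary_t k : sqnorm (gradt_f D (p k.+1) (q k.+1) (t k.+1)) <=
  sigma_max H3 ^+ 2 * dt k.
Proof. by rewrite opt_t sqnormN; exact: (sqnorm_mulmx_le _ n3_gt0 H3pos). Qed.

(** Inserting [opt_q] cancels the gradient of [pgo_g] and leaves the proximal term and the change of
    the gradient of [pgo_f] from [t k] to [t k.+1]. *)
Lemma stationary_q k :
  sqnorm (gradq_f D (p k.+1) (q k.+1) (t k.+1) + gradq_g D (p k.+1) (q k.+1)
          + lam k.+1)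
  <= 2 * Lf ^+ 2 * dt k + 2 * sigma_max H2 ^+ 2 * dq k.
Proof.
rewrite opt_q.
have -> (F F' G h : 'rV[R]_(n * 4)) : F + G - (F' + G + h) = (F - F') - h.
  by rewrite !opprD addrA addrACA subrr addr0.
apply: le_trans (sqnormD_le _ _) _; rewrite sqnormN.
have := lip_gradq_f k.+1 k.+1 k.+1 k.+1 k.+1 k.
rewrite (subrr (p _)) (subrr (q _)) [sqnorm 0]dot0l !add0r => leF.
have scalar (F h x y s : R) : F <= Lf ^+ 2 * x -> h <= s ^+ 2 * y ->
  2 * F + 2 * h <= 2 * Lf ^+ 2 * x + 2 * s ^+ 2 * y by lra.
exact: scalar leF (sqH2 _).
Qed.

(** [dist_normal_cone_le] is used with the normal vector of [opt_p]. Adding it cancels [lam k] and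
    [p k.+1] in the penalty, leaving four differences, one for each summand of the constant. *)
Lemma stationary_p k :
  dist (orth_proj (tangent (p k.+1))
          (- gradp_f D (p k.+1) (q k.+1) (t k.+1) - gradp_g D (p k.+1) (q k.+1)
           + lam k.+1))
       (normal_cone (p k.+1))
  <= (Lf + Lg + beta + sigma_max H1) * enorm (w k.+1 - w k).
Proof.
apply: le_trans (dist_normal_cone_le _ (iter_Un k.+1) (@opt_p k)) _.
have lamE : lam k.+1 = lam k - beta *: (p k.+1 - q k.+1).
  by rewrite iter_lam opprB addrCA subrr addr0.
rewrite lamE.
have -> (F F' G G' l P Q Q' h : 'rV[R]_(n * 4)) :
    - F' - G' + (l - beta *: (P - Q')) + (F + G - l + beta *: (P - Q) + h)
    = (- (F' - F) - (G' - G)) + beta *: (Q' - Q) + h.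
  by apply/rowP => j; rewrite !mxE; ring.
have wE : w k.+1 - w k =
  row_mx (p k.+1 - p k) (row_mx (q k.+1 - q k) (t k.+1 - t k)) by exact: witerB.
apply: le_trans (enormD _ _) _; rewrite [leRHS]mulrDl; apply: lerD; last first.
  rewrite enorm_le ?mulr_ge0 ?enorm_ge0 //.
  apply: le_trans (sqnorm_mulmx_le _ n4_gt0 H1pos) _.
  rewrite exprMn ler_wpM2l ?sqr_ge0 // enorm_sqr wE sqnorm_row_mx lerDl.
  exact: sqnorm_ge0.
apply: le_trans (enormD _ _) _; rewrite [leRHS]mulrDl; apply: lerD; last first.
  rewrite enormZ (gtr0_norm beta_gt0) ler_wpM2l ?(ltW beta_gt0) // wE.
  exact: le_trans (enorm_row_mxl _ _) (enorm_row_mxr _ _).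
apply: le_trans (enormD _ _) _; rewrite [leRHS]mulrDl; apply: lerD; rewrite enormN.
  by rewrite wE; exact: lip_gradp_f.
apply: le_trans (lip_gradp_g _ _ _ _) _; rewrite ler_wpM2l ?(ltW Lg_gt0) // wE.
rewrite enorm_le ?enorm_ge0 // enorm_sqr !sqnorm_row_mx addrA lerDl.
exact: sqnorm_ge0.
Qed.

(* The squared residuals in [p], [q], [t] and the feasibility gap are at most
   [kappa4], [kappa3], [kappa2] and [kappa1] times [theta], respectively. *)
Lemma stationary kappa eps k : 0 < eps -> 0 < kappa ->
  4 / beta ^+ 2 * (Lf ^+ 2 + Lg ^+ 2 + sigma_max H2 ^+ 2) <= kappa ->
  sigma_max H3 ^+ 2 <= kappa ->
  Num.max (2 * Lf ^+ 2) (2 * sigma_max H2 ^+ 2) <= kappa ->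
  (Lf + Lg + beta + sigma_max H1) ^+ 2 <= kappa ->
  theta p q t k.+2 <= eps ^+ 2 / kappa ->
  eps_stationary_with D eps (p k.+2) (q k.+2) (t k.+2) (lam k.+2).
Proof.
move=> eps_gt0 kappa_gt0 le1 le2 le3 le4; rewrite ler_pdivlMr // mulrC => small.
have sE : theta p q t k.+2 = dp k.+1 + dq k.+1 + dt k.+1 + (dp k + dq k + dt k).
  by rewrite thetaE !sqnorm_witer_step.
have [x2 y2 z2] : [/\ 0 <= dp k.+1, 0 <= dq k.+1 & 0 <= dt k.+1].
  by split; exact: sqnorm_ge0.
have [x1 y1 z1] : [/\ 0 <= dp k, 0 <= dq k & 0 <= dt k].
  by split; exact: sqnorm_ge0.
have th0 : 0 <= theta p q t k.+2 by rewrite sE !addr_ge0.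
have bound c x : c <= kappa -> 0 <= x -> x <= theta p q t k.+2 -> c * x <= eps ^+ 2.
  move=> cle x0 xle; apply: le_trans small.
  by apply: le_trans (ler_wpM2r x0 cle) _; rewrite ler_wpM2l // ltW.
move: le3; rewrite ge_max => /andP [le31 le32].
have eps_ge0 := ltW eps_gt0.
split.
- apply: le_trans (stationary_p _) _.
  have L_ge0 : 0 <= Lf + Lg + beta + sigma_max H1.
    by rewrite addr_ge0 // ltW // !addr_gt0.
  rewrite -ler_sqr ?nnegrE ?mulr_ge0 ?enorm_ge0 //.
  rewrite exprMn enorm_sqr bound ?sqnorm_ge0 // thetaE lerDl.
  exact: sqnorm_ge0.
- rewrite enorm_le //; apply: le_trans (stationary_q _) _.
  apply: (@le_trans _ _ (kappa * (dt k.+1 + dq k.+1))).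
    by rewrite [leRHS]mulrDr lerD // ler_wpM2r.
  by rewrite bound // ?addr_ge0 // sE; lra.
- rewrite enorm_le //; apply: le_trans (stationary_t _) _.
  by rewrite bound // sE; lra.
- rewrite enorm_le //; apply: le_trans (stationary_feasibility _) _.
  exact: bound.
Qed.

End PieADMM.

(** * Positivity of [nu] and the iteration bound *)

Lemma half_gap_gt0 (R : realFieldType) (beta S K : R) :
  0 < beta -> 8 * K < beta * S -> 0 < 2^-1 * S - 4 / beta * K.
Proof.
move=> beta_gt0 KS.
have -> : 2^-1 * S - 4 / beta * K = (beta * S - 8 * K) / (2 * beta).
  by field; rewrite gt_eqF.
by rewrite divr_gt0 ?mulr_gt0 // subr_gt0.
Qed.

Theorem theorem5p2 (R : realType) (n : nat) (n_gt0 : (0 < n)%N)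
    (D : pgo_data R n)
    (beta : R) (tau1 tau2 : 'I_n -> R)
    (H1 H2 : 'M[R]_(n * 4)) (H3 : 'M[R]_(n * 3))
    (p q lam : nat -> 'rV[R]_(n * 4)) (t : nat -> 'rV[R]_(n * 3))
    (Bp Bq : set 'rV[R]_(n * 4)) (Bt : set 'rV[R]_(n * 3))
    (Lf Lg Lfp Lgp Lfq Lgq : R) (eps : R) :
  0 < beta ->
  H1 = scalar_blocks 4 tau1 -> H2 = scalar_blocks 4 tau2 ->
  block_diagonal H3 ->
  posdef H1 -> posdef H2 -> posdef H3 ->
  pieadmm D beta H1 H2 H3 p q t lam ->
  bounded_fun p -> bounded_fun q -> bounded_fun t -> bounded_fun lam ->
  bounded_set Bp -> bounded_set Bq -> bounded_set Bt ->
  @Un R n `<=` Bp ->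
  (forall k, Bp (p k)) -> (forall k, Bq (q k)) -> (forall k, Bt (t k)) ->
  0 < Lf -> 0 < Lg -> 0 < Lfp -> 0 < Lgp -> 0 < Lfq -> 0 < Lgq ->
  lipschitz_constants D Bp Bq Bt Lf Lg Lfp Lgp Lfq Lgq ->
  posdef (H1 - (Lfp%:M + Lgp%:M)) ->
  Num.max (4 / 3 * (Lfq + Lgq))
    (Num.max (8 * (Lf ^+ 2 + Lg ^+ 2) / (sigma_min H1 - Lfp - Lgp))
      (Num.max ((8 * (Lf ^+ 2 + Lg ^+ 2) + 16 * sigma_max H2 ^+ 2)
                  / sigma_min H2)
               (8 * Lf ^+ 2 / sigma_min H3))) < beta ->
  0 < eps ->
  let kappa1 := 4 / beta ^+ 2 * (Lf ^+ 2 + Lg ^+ 2 + sigma_max H2 ^+ 2) in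
  let kappa2 := sigma_max H3 ^+ 2 in
  let kappa3 := Num.max (2 * Lf ^+ 2) (2 * sigma_max H2 ^+ 2) in
  let kappa4 := (Lf + Lg + beta + sigma_max H1) ^+ 2 in
  let kappa := Num.max kappa1 (Num.max kappa2 (Num.max kappa3 kappa4)) in
  let nu :=
    Num.min (2^-1 * (sigma_min H1 - Lfp - Lgp)
               - 4 / beta * (Lf ^+ 2 + Lg ^+ 2))
      (Num.min (2^-1 * sigma_min H2 - 4 / beta * (Lf ^+ 2 + Lg ^+ 2)
                  - 8 / beta * sigma_max H2 ^+ 2)
               (2^-1 * sigma_min H3 - 4 / beta * Lf ^+ 2)) in
  let T : int :=
    Num.ceil (2 * kappa / (nu * eps ^+ 2)
              * (merit D p q t beta Lf H2 lam 1 - fstar D - gstar D)) in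
  exists khat : nat,
    [/\ (2 <= khat)%N,
        theta p q t khat <= eps ^+ 2 / kappa
      & forall k : nat, (2 <= k < khat)%N ->
          ~ (theta p q t k <= eps ^+ 2 / kappa)] /\
    [/\ eps_stationary_with D eps (p khat) (q khat) (t khat) (lam khat),
        eps_stationary D eps (p khat) (q khat) (t khat)
      & khat%:Z <= Num.max T 1 + 2].
Proof.
move=> beta_gt0 H1E _ _ H1pos H2pos H3pos iter _ _ _ _ _ _ _ _ pB qB tB.
move=> Lf_gt0 Lg_gt0 _ _ _ _ lip H1L.
rewrite !gt_max => /and4P [beta_gtq beta_gt1 beta_gt2 beta_gt3] eps_gt0.
move=> kappa1 kappa2 kappa3 kappa4 kappa nu T.
move: H1pos iter H1L beta_gt1 @kappa4 @kappa @nu @T; rewrite H1E.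
set H := scalar_blocks 4 tau1 => H1pos iter H1L beta_gt1 kappa4 kappa nu T.
have n4_gt0 : (0 < n * 4)%N by rewrite muln_gt0 n_gt0.
have n3_gt0 : (0 < n * 3)%N by rewrite muln_gt0 n_gt0.
have s1_gt : Lfp + Lgp < sigma_min H.
  apply: sigma_min_gt => //; first by case: H1pos.
  by rewrite raddfD.
have gap_gt0 : 0 < sigma_min H - Lfp - Lgp by lra.
have s2_gt0 := posdef_sigma_min_gt0 n4_gt0 H2pos.
have s3_gt0 := posdef_sigma_min_gt0 n3_gt0 H3pos.
have nu_gt0 : 0 < nu.
  rewrite /nu !lt_min; apply/and3P; split.
  - by apply: half_gap_gt0; rewrite // -ltr_pdivrMr.
  - have -> : 2^-1 * sigma_min H2 - 4 / beta * (Lf ^+ 2 + Lg ^+ 2)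
        - 8 / beta * sigma_max H2 ^+ 2
      = 2^-1 * sigma_min H2
        - 4 / beta * (Lf ^+ 2 + Lg ^+ 2 + 2 * sigma_max H2 ^+ 2) by ring.
    apply: half_gap_gt0; rewrite // -ltr_pdivrMr //.
    by congr (_ / _ < _): beta_gt2; ring.
  - by apply: half_gap_gt0; rewrite // -ltr_pdivrMr.
have kappa1_le : kappa1 <= kappa by rewrite !le_max lexx.
have kappa2_le : kappa2 <= kappa by rewrite !le_max lexx !orbT.
have kappa3_le : kappa3 <= kappa.
  by rewrite /kappa; move: (kappa3) => z; rewrite !le_max lexx !orbT.
have kappa4_le : kappa4 <= kappa by rewrite !le_max lexx !orbT.
have kappa_gt0 : 0 < kappa.
  apply: lt_le_trans kappa4_le; rewrite exprn_gt0 // addr_gt0 ?addr_gt0 //.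
  exact: posdef_sigma_max_gt0.
pose delta := eps ^+ 2 / kappa.
have delta_gt0 : 0 < delta by rewrite divr_gt0 ?exprn_gt0.
(* [theta_small] requires a summand even when [T] is not positive, hence the maximum with 1. As its
   sums start at [theta 3], the index found is at most [N + 2]. *)
pose N := `|Num.max T 1|%N.
have NE : N%:Z = Num.max T 1 by rewrite gez0_abs // le_max orbT.
have N_gt0 : (0 < N)%N by rewrite -ltz_nat NE lt_max orbT.
have leN : 2 / (nu * delta) *
    (merit D p q t beta Lf H2 lam 1 - fstar D - gstar D) <= N%:R.
  have -> : 2 / (nu * delta) = 2 * kappa / (nu * eps ^+ 2).
    by rewrite /delta; field; rewrite !gt_eqF.
  have -> : N%:R = (Num.max T 1)%:~R :> R by rewrite -NE.
  by rewrite -ceil_le_int -/T le_max lexx.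
have [k0 /andP [k0_ge2 k0_le] small0] :=
  theta_small n_gt0 beta_gt0 H1pos H2pos H3pos iter pB qB tB Lf_gt0 Lg_gt0 lip
    beta_gtq nu_gt0 delta_gt0 N_gt0 leN.
(* The first small index is the least element of [P]; [k0] only bounds it. *)
pose P k := (2 <= k)%N && (theta p q t k <= delta).
have exP : exists k, P k by exists k0; rewrite /P k0_ge2.
case: (ex_minnP exP) => khat /andP [khat_ge2 small] khat_min.
have stat : eps_stationary_with D eps (p khat) (q khat) (t khat) (lam khat).
  case: khat khat_ge2 small {khat_min} => [|[|k]] // _ small.
  by apply: (stationary n_gt0 beta_gt0 H1pos H2pos H3pos iter pB qB tB Lf_gt0
    Lg_gt0 lip eps_gt0 kappa_gt0).
exists khat; split; last first.
  split=> //; first by exists (lam khat).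
  rewrite -NE -[2]/(2%:Z) -PoszD lez_nat addn2; apply: leq_trans k0_le.
  by apply: khat_min; rewrite /P k0_ge2.
split=> // k /andP [k_ge2 k_lt] k_small.
by have := khat_min k; rewrite /P k_ge2 k_small leqNgt k_lt => /(_ isT).
Qed.
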